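(* Assume the strong Atkinson condition (SAC) holds and that $q_+=q_-=:q$. Fix $\lambda_0\in\mathbb{C}$ with $\operatorname{Im}\lambda_0>0$, let $\varphi^{[1]},\dots,\varphi^{[q]}$ be linearly independent square summable solutions of $(S_{\lambda_0})$ and $\varphi^{[q+1]},\dots,\varphi^{[2q]}$ be linearly independent square summable solutions of $(S_{\bar\lambda_0})$, and assume that $\varphi^{[1]},\dots,\varphi^{[q]}$ are arranged so that the matrix $\big((\varphi^{[i]},\varphi^{[q+j]})_{N+1}\big)_{1\le i\le 2q-2n,\ 1\le j\le q}$ has rank $2q-2n$. Let $\Omega_{2q-2n}:=\big((\varphi^{[i]},\varphi^{[j]})_{N+1}\big)_{i,j=1}^{2q-2n}$. Then a linear relation $T\subseteq\tilde\ell^{2}_{\Psi}\times\tilde\ell^{2}_{\Psi}$ is a self-adjoint extension of $T_{\min}$ if and only if there exist matrices $M\in\mathbb{C}^{q\times 2n}$ and $L\in\mathbb{C}^{q\times(2q-2n)}$ such that $$\operatorname{rank}(M,L)=q,\qquad M\mathcal{J}M^*-L\,\Omega_{2q-2n}\,L^*=0,$$ and $$T=\left\{\{\tilde z,\tilde f\}\in T_{\max}\ \middle|\ M\hat z_0-L\begin{pmatrix}(\varphi^{[1]},\hat z)_{N+1}\\ \vdots\\ (\varphi^{[2q-2n]},\hat z)_{N+1}\end{pmatrix}=0\right\}.$$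
   Context: Let $n\ge 1$ be an integer and $\mathcal{J}=\begin{pmatrix}0&I\\-I&0\end{pmatrix}\in\mathbb{C}^{2n\times 2n}$. Let $N\in\{0,1,2,\dots\}\cup\{\infty\}$; put $\mathcal{I}=\{0,\dots,N\}$ and $\mathcal{I}^+=\{0,\dots,N+1\}$ if $N<\infty$, and $\mathcal{I}=\mathcal{I}^+=\{0,1,2,\dots\}$ if $N=\infty$. For each $k\in\mathcal{I}$ let $\mathcal{S}_k,\Psi_k\in\mathbb{C}^{2n\times 2n}$ satisfy $\mathcal{S}_k^*\mathcal{J}\mathcal{S}_k=\mathcal{J}$, $\Psi_k^*=\Psi_k$, $\Psi_k^*\mathcal{J}\Psi_k=0$, $\Psi_k\ge 0$ (positive semidefinite). Put $\mathcal{V}_k=-\mathcal{J}\Psi_k\mathcal{S}_k$. For $\lambda\in\mathbb{C}$ the discrete symplectic system $(S_\lambda)$ is $z_k=(\mathcal{S}_k+\lambda\mathcal{V}_k)z_{k+1}$, $k\in\mathcal{I}$, for $z:\mathcal{I}^+\to\mathbb{C}^{2n}$. Let $\mathscr{L}(z)_k=\mathcal{J}(z_k-\mathcal{S}_kz_{k+1})$, $k\in\mathcal{I}$; $(S_\lambda)$ is equivalent to $\mathscr{L}(z)_k=\lambda\Psi_kz_k$. Strong Atkinson condition (SAC): there is a finite discrete interval $\{a,a+1,\dots,b\}\subseteq\mathcal{I}$ such that for every $\lambda\in\mathbb{C}$ every nontrivial solution $z$ of $(S_\lambda)$ satisfies $\sum_{k=a}^b z_k^*\Psi_kz_k>0$.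 For sequences $z,u$ on $\mathcal{I}^+$ put $\langle z,u\rangle_\Psi=\sum_{k\in\mathcal{I}}z_k^*\Psi_ku_k$ and $\|z\|_\Psi=\sqrt{\langle z,z\rangle_\Psi}$; $\ell^2_\Psi$ is the space of $z:\mathcal{I}^+\to\mathbb{C}^{2n}$ with $\|z\|_\Psi<\infty$ (''square summable''), and $\tilde\ell^2_\Psi$ is the Hilbert space of equivalence classes of $\ell^2_\Psi$ modulo $\{z:\|z\|_\Psi=0\}$. A linear relation is a linear subspace $T$ of $\tilde\ell^2_\Psi\times\tilde\ell^2_\Psi$; its elements are pairs $\{\tilde z,\tilde f\}$. The adjoint is $T^*=\{\{\tilde y,\tilde g\}:\langle\tilde z,\tilde g\rangle_\Psi=\langle\tilde f,\tilde y\rangle_\Psi\ \forall\{\tilde z,\tilde f\}\in T\}$; $T$ is self-adjoint if $T=T^*$, and $T$ is a self-adjoint extension of $T'$ if moreover $T'\subseteq T$. Maximal relation: $T_{\max}=\{\{\tilde z,\tilde f\}:\exists u\in\tilde z,\ \mathscr{L}(u)_k=\Psi_kf_k\ \forall k\in\mathcal{I}\}$ (independent of the representative $f\in\tilde f$). Under (SAC) the element $u\in\tilde z$ is unique for each pair $\{\tilde z,\tilde f\}\in T_{\max}$ and is denoted $\hat z$ (it is determined by the pair). Minimal relation: $T_{\min}=\overline{T_0}$, where $T_0$ is the set of $\{\tilde z,\tilde f\}$ for which there is $u\in\tilde z$ with finite support, $u_0=0$ and, if $N<\infty$, also $u_{N+1}=0$, such that $\mathscr{L}(u)_k=\Psi_kf_k$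 for all $k\in\mathcal{I}$. $(z,u)_k:=z_k^*\mathcal{J}u_k$; when $N=\infty$, $(z,u)_{N+1}$ means $\lim_{k\to\infty}(z,u)_k$, which exists for the sequences considered here. Let $q(\lambda)$ be the dimension of the space of square summable solutions of $(S_\lambda)$. Under (SAC), $q(\lambda)$ is constant on the open upper and on the open lower half-plane; these constants are denoted $q_+$ and $q_-$, and $n\le q_\pm\le 2n$. When $2q-2n=0$ the matrix $L$ and the corresponding terms are absent. *)

(* Defs.v *)
From HB Require Import structures.
From mathcomp Require Import all_boot all_order all_algebra.
From mathcomp Require Import complex.
From mathcomp Require Import all_classical all_reals all_analysis.
From mathcomp Require Import ring.

Set Implicit Arguments.
Unset Strict Implicit.
Unset Printing Implicit Defensive.

Import Order.TTheory GRing.Theory Num.Theory.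
Import numFieldNormedType.Exports.

Local Open Scope classical_set_scope.
Local Open Scope ring_scope.
Local Open Scope sesquilinear_scope.
Local Open Scope quotient_scope.

(* The complex numbers as a numClosedFieldType, so that convergence in CC R is
   that of its norm topology. *)
Definition CC (R : realType) : numClosedFieldType := R[i].

(* The length N is an [option nat], with None standing for infinity. *)
Definition inI (N : option nat) (k : nat) : bool :=
  if N is Some m then (k <= m)%N else true.
Definition inIp (N : option nat) (k : nat) : bool :=
  if N is Some m then (k <= m.+1)%N else true.
Definition Ip (N : option nat) : Type := {k : nat | inIp N k}.

Definition Jmx (R : realType) (n : nat) : 'M[CC R]_(n + n) :=
  block_mx 0 1%:M (- 1%:M) 0.

Definition psdmx (R : realType) (m : nat) (A : 'M[CC R]_m) : Prop :=
  forall v : 'cV[CC R]_m, 0 <= (v ^t* *m A *m v) 0 0.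

(* The coefficients are total functions of k : nat, but they are constrained
   and used only for k in I. *)
Record dsystem (R : realType) (n : nat) (N : option nat) := DSystem {
  Smx : nat -> 'M[CC R]_(n + n);
  Psi : nat -> 'M[CC R]_(n + n);
  Smx_symplectic : forall k, inI N k ->
    (Smx k) ^t* *m Jmx R n *m Smx k = Jmx R n;
  Psi_hermitian : forall k, inI N k -> (Psi k) ^t* = Psi k;
  Psi_isotropic : forall k, inI N k -> (Psi k) ^t* *m Jmx R n *m Psi k = 0;
  Psi_psd : forall k, inI N k -> psdmx (Psi k)
}.

Notation dseq R n N := (Ip N -> 'cV[CC R]_(n + n)).

(* z_k, extended by 0 to the k outside I^+. *)
Definition ev (R : realType) (n : nat) (N : option nat)
    (z : dseq R n N) (k : nat) : 'cV[CC R]_(n + n) := oapp z 0 (insub k).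

Section System.
Variables (R : realType) (n : nat) (N : option nat) (Y : dsystem R n N).

Local Notation C := (CC R).
Local Notation seqs := (dseq R n N).
Local Notation J := (Jmx R n).

Definition Vmx (k : nat) : 'M[C]_(n + n) := - J *m Psi Y k *m Smx Y k.

Definition solution (lam : C) (z : seqs) : Prop :=
  forall k, inI N k -> ev z k = (Smx Y k + lam *: Vmx k) *m ev z k.+1.

Definition Lop (z : seqs) (k : nat) : 'cV[C]_(n + n) :=
  J *m (ev z k - Smx Y k *m ev z k.+1).

Definition wform (z u : seqs) (k : nat) : C :=
  ((ev z k) ^t* *m Psi Y k *m ev u k) 0 0.

Definition SAC : Prop :=
  exists a b : nat, [/\ (a <= b)%N, inI N b &
    forall (lam : C) (z : seqs), solution lam z -> z <> 0 ->
      0 < \sum_(a <= k < b.+1) wform z z k].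

(* The squared seminorm as an extended real; its terms are real and
   nonnegative. *)
Definition normsq (z : seqs) : \bar R :=
  (\sum_(k <oo | inI N k) (complex.Re (wform z z k))%:E)%E.

Definition ell2 : {pred seqs} := fun z => `[< (normsq z < +oo)%E >].

Definition inner (z u : seqs) : C :=
  limn (fun m : nat => \sum_(0 <= k < m | inI N k) wform z u k : C).

Definition bracket (z u : seqs) (k : nat) : C :=
  ((ev z k) ^t* *m J *m ev u k) 0 0.

Definition bracket_end (z u : seqs) : C :=
  if N is Some m then bracket z u m.+1
  else limn (fun k : nat => bracket z u k : C).

Definition sqsol (lam : C) : set seqs :=
  [set z | solution lam z /\ z \in ell2].

Lemma evD z u k : ev (z + u : seqs) k = ev z k + ev u k.
Proof. by rewrite /ev; case: insub => [i|] //=; rewrite addr0. Qed.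

Lemma evZ (a : C) z k : ev (a *: z : seqs) k = a *: ev z k.
Proof. by rewrite /ev; case: insub => [i|] //=; rewrite scaler0. Qed.

Lemma wform_ge0 z k : inI N k -> 0 <= wform z z k.
Proof. by move=> Ik; apply: Psi_psd. Qed.

Lemma Re_wform_ge0 z k : inI N k -> 0 <= complex.Re (wform z z k).
Proof. by move=> /(wform_ge0 z); rewrite lecE => /andP[]. Qed.


Lemma wformDr z u v k : wform z (u + v) k = wform z u k + wform z v k.
Proof. by rewrite /wform evD mulmxDr mxE. Qed.

Lemma wformZr (a : C) z u k : wform z (a *: u) k = a * wform z u k.
Proof. by rewrite /wform evZ -scalemxAr mxE. Qed.

Lemma wformDl z u v k : wform (z + u) v k = wform z v k + wform u v k.
Proof.
rewrite /wform evD.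
have -> : (ev z k + ev u k) ^t* = (ev z k) ^t* + (ev u k) ^t*.
  by apply/matrixP => i j; rewrite !mxE rmorphD.
by rewrite mulmxDl mulmxDl mxE.
Qed.

Lemma wformZl (a : C) z v k : wform (a *: z) v k = a^* * wform z v k.
Proof.
rewrite /wform evZ.
have -> : (a *: ev z k) ^t* = a^* *: (ev z k) ^t*.
  by apply/matrixP => i j; rewrite !mxE rmorphM.
by rewrite -!scalemxAl mxE.
Qed.

Lemma wform_parallelogram z u k :
  wform (z + u) (z + u) k + wform (z - u) (z - u) k =
  2 * (wform z z k + wform u u k).
Proof.
rewrite -(scaleN1r u) (wformDl z u) (wformDr z z u) (wformDr u z u).
rewrite (wformDl z (-1 *: u)) (wformDr z z) (wformDr (-1 *: u) z).
rewrite (wformZr _ z) (wformZl _ u z) (wformZl _ u (-1 *: u)) (wformZr _ u u).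
rewrite rmorphN1.
move: (wform z z k) (wform z u k) (wform u z k) (wform u u k) => a b c d.
ring.
Qed.

Lemma ReD (x y : C) :
  complex.Re (x + y) = complex.Re x + complex.Re y.
Proof. by case: x; case: y. Qed.

Lemma normsqD_le (z u : seqs) :
  (normsq (z + u)%R <= 2%:E * (normsq z + normsq u))%E.
Proof.
rewrite /normsq -nneseriesD; last 2 first.
- by move=> k _ Ik; rewrite lee_fin; exact: Re_wform_ge0.
- by move=> k _ Ik; rewrite lee_fin; exact: Re_wform_ge0.
rewrite -nneseriesZl; last 1 first.
- by move=> k Ik; rewrite -EFinD lee_fin addr_ge0 //; exact: Re_wform_ge0.
apply: lee_nneseries => [k _ Ik|k Ik]; first by rewrite lee_fin Re_wform_ge0.
rewrite -EFinD -EFinM lee_fin.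
have := congr1 (@complex.Re R) (wform_parallelogram z u k).
rewrite mulr_natl mulr2n !ReD => eq2.
rewrite mulr_natl mulr2n -eq2 lerDl; exact: Re_wform_ge0.
Qed.

Lemma normsqZ (a : C) (z : seqs) :
  normsq (a *: z) = ((complex.Re (`|a| ^+ 2)%R)%:E * normsq z)%E.
Proof.
have Ra : `|a| ^+ 2 = (complex.Re (`|a| ^+ 2) : R)%:C%C :> C.
  by rewrite RRe_real // realX // normr_real.
rewrite /normsq -nneseriesZl; last first.
  by move=> k Ik; rewrite lee_fin Re_wform_ge0.
apply: eq_eseriesr => k Ik; rewrite wformZl wformZr mulrA [a^* * a]mulrC -normCK.
rewrite -EFinM; congr EFin.
rewrite [in LHS]Ra; case: (wform z z k) => x y /=.
by rewrite !mul0r !subr0.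
Qed.

Lemma normsq0 : normsq 0 = 0%E.
Proof. by rewrite -[0](scale0r 0) normsqZ normr0 expr0n /= mul0e. Qed.

Lemma normsq_ge0 (z : seqs) : (0 <= normsq z)%E.
Proof. by apply: nneseries_ge0 => k _ Ik; rewrite lee_fin Re_wform_ge0. Qed.

Lemma ell2_submod_closed : submod_closed ell2.
Proof.
split=> [|a z u]; first by apply/asboolP; rewrite normsq0 ltry.
move=> /asboolP z2 /asboolP u2; apply/asboolP.
apply: le_lt_trans (normsqD_le _ _) _.
apply: lte_mul_pinfty; [by rewrite lee_fin| by [] |].
apply: lte_add_pinfty; last exact: u2.
rewrite normsqZ; apply: lte_mul_pinfty; [|by []|exact: z2].
have : 0 <= `|a| ^+ 2 by apply: exprn_ge0; exact: normr_ge0.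
by rewrite lee_fin lecE => /andP[].
Qed.

HB.instance Definition _ :=
  GRing.isSubmodClosed.Build C seqs ell2 ell2_submod_closed.

Record l2seq := L2seq { l2val :> seqs; _ : l2val \in ell2 }.

HB.instance Definition _ := [isSub for l2val].
HB.instance Definition _ := [Choice of l2seq by <:].
HB.instance Definition _ := [SubChoice_isSubLmodule of l2seq by <:].

Definition l2null : {pred l2seq} := fun z => `[< normsq z = 0%E >].

Lemma l2null_submod_closed : submod_closed l2null.
Proof.
split=> [|a z u]; first by apply/asboolP; exact: normsq0.
move=> /asboolP z0 /asboolP u0; apply/asboolP/eqP.
rewrite eq_le normsq_ge0 andbT.
apply: le_trans (normsqD_le (a *: (z : seqs)) (u : seqs)) _.
by rewrite normsqZ z0 u0 mule0 adde0 mule0.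
Qed.

HB.instance Definition _ :=
  GRing.isSubmodClosed.Build C l2seq l2null l2null_submod_closed.

Definition l2class : Type := Quotient.quot l2null.
HB.instance Definition _ := EqQuotient.on l2class.
HB.instance Definition _ := GRing.Zmodule.on l2class.

Definition cls (z : l2seq) : l2class := \pi_l2class z.

Lemma clsE (z u : l2seq) : cls z = cls u <-> normsq (z - u) = 0%E.
Proof.
split=> [/eqP|zu]; first by rewrite -[_ == _]Quotient.idealrBE => /asboolP.
by apply/eqP; rewrite -[_ == _]Quotient.idealrBE; apply/asboolP.
Qed.

Lemma clsD (z u : l2seq) : cls (z + u) = cls z + cls u.
Proof. exact: (Quotient.pi_add l2null z u). Qed.

Lemma reprclsK (Z : l2class) : cls (repr Z) = Z.
Proof. exact: reprK. Qed.

Definition scale_class (a : C) (Z : l2class) : l2class := cls (a *: repr Z).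

Lemma scale_cls a (z : l2seq) : scale_class a (cls z) = cls (a *: z).
Proof.
apply/clsE; rewrite -[X in normsq X]/(val (a *: repr (cls z) - a *: z)).
have /clsE rz := reprclsK (cls z).
rewrite -scalerBr; have -> : val (a *: (repr (cls z) - z)) =
  a *: val (repr (cls z) - z) by [].
by rewrite normsqZ rz mule0.
Qed.

Fact scale_classA a b Z :
  scale_class a (scale_class b Z) = scale_class (a * b) Z.
Proof. by rewrite -[Z]reprclsK !scale_cls scalerA. Qed.
Fact scale_class1 : left_id 1 scale_class.
Proof. by move=> Z; rewrite -[Z]reprclsK !scale_cls scale1r. Qed.
Fact scale_classDr : right_distributive scale_class +%R.
Proof.
move=> a Z U; rewrite -[Z]reprclsK -[U]reprclsK -clsD !scale_cls.
by rewrite scalerDr clsD.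
Qed.
Fact scale_classDl Z : {morph scale_class^~ Z : a b / a + b}.
Proof. by move=> a b; rewrite -[Z]reprclsK !scale_cls scalerDl clsD. Qed.

HB.instance Definition _ := GRing.Zmodule_isLmodule.Build C l2class
  scale_classA scale_class1 scale_classDr scale_classDl.

(* The choice of representatives is immaterial: normsq z = 0 means that
   Psi_k z_k = 0 for all k in I. *)
Definition cinner (Z U : l2class) : C := inner (repr Z) (repr U).
Definition cnorm (Z : l2class) : R := Num.sqrt (fine (normsq (repr Z))).

Local Notation rel := (set (l2class * l2class)).

Definition linear_relation (T : rel) : Prop :=
  T 0 /\ forall (a : C) (p r : l2class * l2class), T p -> T r -> T (a *: p + r).

Definition adjoint (T : rel) : rel :=
  [set p | forall r, T r -> cinner r.1 p.2 = cinner r.2 p.1].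

Definition self_adjoint (T : rel) : Prop := T = adjoint T.

(* Closure in the product of the norm topologies. *)
Definition relclosure (T : rel) : rel :=
  [set p | forall eps : R, 0 < eps -> exists r, [/\ T r,
     cnorm (p.1 - r.1) < eps & cnorm (p.2 - r.2) < eps]].

(* [represents p u] : u belongs to the class p.1 and L(u) = Psi f on I for a
   representative f of the class p.2. *)
Definition represents (p : l2class * l2class) (u : l2seq) : Prop :=
  cls u = p.1 /\
  (exists2 f : l2seq, cls f = p.2 &
     forall k, inI N k -> Lop u k = Psi Y k *m ev f k).

Definition Tmax : rel := [set p | exists u, represents p u].

Definition T0 : rel :=
  [set p | exists u, [/\ represents p u,
     (exists m : nat, forall k, (m <= k)%N -> ev u k = 0),
     ev u 0 = 0 &
     (forall m, N = Some m -> ev u m.+1 = 0)]].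

Definition Tmin : rel := relclosure T0.

(* A representative of p solving the system; it is unique under SAC. *)
Definition hat (p : l2class * l2class) : l2seq := xget 0 [set u | represents p u].

End System.

Arguments Tmax {R n N} Y _.
Arguments T0 {R n N} Y _.
Arguments Tmin {R n N} Y _.

Definition lin_indep (R : realType) (n : nat) (N : option nat) (d : nat)
    (b : 'I_d -> dseq R n N) : Prop :=
  forall c : 'I_d -> CC R, \sum_(i < d) c i *: b i = 0 -> forall i, c i = 0.

Definition has_dim (R : realType) (n : nat) (N : option nat)
    (W : set (dseq R n N)) (d : nat) : Prop :=
  exists b : 'I_d -> dseq R n N, lin_indep b /\
    W = [set z | exists c : 'I_d -> CC R, z = \sum_(i < d) c i *: b i].

(* Under SAC the dimension of sqsol Y lam is constant on each open half-plane;
   q_+ and q_- are these constants. *)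
Definition is_qplus (R : realType) (n : nat) (N : option nat)
    (Y : dsystem R n N) (q : nat) : Prop :=
  forall lam : CC R, 0 < complex.Im lam -> has_dim (sqsol Y lam) q.
Definition is_qminus (R : realType) (n : nat) (N : option nat)
    (Y : dsystem R n N) (q : nat) : Prop :=
  forall lam : CC R, complex.Im lam < 0 -> has_dim (sqsol Y lam) q.

(* For q >= n, [head_idx i] is the i-th index, i < 2q - 2n, of a family of 2q
   sequences. *)
Definition head_idx (q n : nat) (i : 'I_(q + q - (n + n))) : 'I_(q + q) :=
  widen_ord (leq_subr (n + n) (q + q)) i.

(* Main.v *)
(* On T_max the form omega(p, r) = <f_p, z_r> - <z_p, f_r> is, by Lagrange's
   identity, the bracket at the endpoint minus the bracket at 0.  Every p in
   T_max is, modulo the radical of omega, a combination of the 2q eigensolutions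
   phi: if p is omega-orthogonal to all of them, then f - conj(lam) z is
   orthogonal to the square summable solutions of S_lam, so its projections on
   the solutions over [0, m) tend to 0, and correcting p by a sequence vanishing
   at 0 and m shows that (lam - conj lam)(<z, f> - <f, z>) >= 0; with conj(lam)
   in place of lam this yields omega(p, p) = 0.  By the strong Atkinson condition
   initial values can be prescribed with finite support, which leaves rank
   2q - 2n for the bracket at the endpoint.  So the boundary values
   (z_0, ((phi_i, z)_{N+1})_i) map T_max onto C^{2q}, with omega given by the
   invertible skew-hermitian matrix B = diag(-J, -Omega^{-1}).  As T_0^* is
   contained in T_max, self-adjoint extensions of T_min are the preimages of the
   subspaces V of C^{2q} with V = V^{perp_B}, that is V = ker (M, -L) with
   (M, -L) of rank q and (M, -L) B^{-1} (M, -L)^* = M J M^* - L Omega L^* = 0. *)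

Require Import Defs.
From mathcomp Require Import all_boot all_order all_algebra.
From mathcomp Require Import complex.
From mathcomp Require Import all_classical all_reals all_analysis.
From mathcomp Require Import ring.

Set Implicit Arguments.
Unset Strict Implicit.
Unset Printing Implicit Defensive.

Import Order.TTheory GRing.Theory Num.Theory.
Import numFieldNormedType.Exports.

Local Open Scope classical_set_scope.
Local Open Scope ring_scope.
Local Open Scope sesquilinear_scope.

(** * Conjugate transposes *)

(** The decomposition of T_max is von Neumann's formula with the radical of omega in place of T_min.
    Its classical proof projects orthogonally in the Hilbert space; here every projection is taken
    over a finite interval [0, m) onto the space of all solutions, which has the fixed dimension 2n.
    SAC makes the Gram matrix of that space invertible once m passes the definiteness interval, so
    the coefficients of the projections converge in C^{2n}, and orthogonality to the square summable
    solutions is used only for the limit. The radical is small enough for the purpose: tested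
    against pairs of finite support its elements have zero initial value, and then Lagrange's
    identity kills their brackets at the endpoint, so boundary values depend only on the component
    along the eigensolutions. Classes modulo the seminorm are kept out of all this: the analysis is
    done with matrix-valued sequences on nat, each collecting a family of sequences as its columns,
    and a right-hand side is used only through Psi. *)

Section Adjoint.
Variable C : numClosedFieldType.
Implicit Types p r s : nat.

Lemma adjmxM p r s (A : 'M[C]_(p, r)) (B : 'M[C]_(r, s)) :
  (A *m B) ^t* = B ^t* *m A ^t*.
Proof. by rewrite trmx_mul map_mxM. Qed.

Lemma adjmxD p r (A B : 'M[C]_(p, r)) : (A + B) ^t* = A ^t* + B ^t*.
Proof. by rewrite linearD map_mxD. Qed.

Lemma adjmxN p r (A : 'M[C]_(p, r)) : (- A) ^t* = - A ^t*.
Proof. by rewrite linearN map_mxN. Qed.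

Lemma adjmxB p r (A B : 'M[C]_(p, r)) : (A - B) ^t* = A ^t* - B ^t*.
Proof. by rewrite adjmxD adjmxN. Qed.

Lemma adjmxZ p r a (A : 'M[C]_(p, r)) : (a *: A) ^t* = a^* *: A ^t*.
Proof. by rewrite linearZ map_mxZ. Qed.

Lemma adjmx0 p r : (0 : 'M[C]_(p, r)) ^t* = 0.
Proof. by rewrite trmx0 map_mx0. Qed.

Lemma adjmx1 p : (1%:M : 'M[C]_p) ^t* = 1%:M.
Proof. by rewrite trmx1 map_mx1. Qed.

Lemma adjmx_sum p r I (s : seq I) (P : pred I) (F : I -> 'M[C]_(p, r)) :
  (\sum_(i <- s | P i) F i) ^t* = \sum_(i <- s | P i) (F i) ^t*.
Proof.
by apply: (big_morph (fun A : 'M[C]_(p, r) => A ^t*) (@adjmxD p r) (adjmx0 p r)).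
Qed.

Lemma adjmx_delta p r (i : 'I_p) (j : 'I_r) :
  (delta_mx i j : 'M[C]_(p, r)) ^t* = delta_mx j i.
Proof. by rewrite trmx_delta map_delta_mx. Qed.

Lemma adjmx_mul_eq0 p (v : 'cV[C]_p) : v ^t* *m v = 0 -> v = 0.
Proof.
move=> /matrixP/(_ 0 0); rewrite mxE [RHS]mxE => /eqP.
rewrite psumr_eq0 => [/allP e|i _]; last by rewrite !mxE mulrC mul_conjC_ge0.
apply/matrixP => i j; rewrite ord1 [RHS]mxE.
have := e i; rewrite mem_index_enum => /(_ isT).
by rewrite !mxE mulrC mul_conjC_eq0 => /eqP.
Qed.

Lemma unitmx_inj p (A : 'M[C]_p) :
  (forall v : 'cV[C]_p, A *m v = 0 -> v = 0) -> A \in unitmx.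
Proof.
move=> A0; rewrite -unitmx_tr -row_free_unit -kermx_eq0; apply/eqP/row_matrixP.
move=> i; rewrite row0; apply: trmx_inj; rewrite trmx0; apply: A0.
by apply: trmx_inj; rewrite trmx_mul trmxK trmx0 -row_mul mulmx_ker row0.
Qed.

(** Cauchy-Schwarz in abstract form: the expression is |x - t y|^2 with a = |x|^2, b = |y|^2, c =
    <x, y>. It is evaluated at its minimiser t = c^* / b; for b = 0 a value with t c = a + 1 makes
    it negative unless c = 0. *)
Lemma discriminant_le (a b c : C) : 0 <= a -> 0 <= b ->
    (forall t, 0 <= a - t * c - t^* * c^* + t * t^* * b) ->
  `|c| ^+ 2 <= a * b.
Proof.
move=> a0 b0 pos; have [bz|bz] := eqVneq b 0.
  rewrite bz mulr0; have [->|c0] := eqVneq c 0; first by rewrite normr0 expr0n.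
  have n0 : `|c| ^+ 2 != 0 by rewrite expf_neq0 // normr_eq0.
  have := pos ((a + 1) / (`|c| ^+ 2) * c^*).
  rewrite bz mulr0 addr0 !rmorphM/= fmorphV conjCK rmorphD rmorph1 rmorphXn/=.
  rewrite (CrealP (ger0_real a0)) (CrealP (normr_real c)).
  have -> : a - (a + 1) / `|c| ^+ 2 * c^* * c - (a + 1) / `|c| ^+ 2 * c * c^* = - (a + 2).
    by rewrite normCK; field; rewrite conjC_eq0 c0.
  by rewrite oppr_ge0 lt_geF // ltr_wpDl.
have {bz}bz : 0 < b by rewrite lt_def bz.
have := pos (c^* / b); rewrite rmorphM /= fmorphV /= conjCK (CrealP (ger0_real b0)).
have -> : a - c^* / b * c - c / b * c^* + c^* / b * (c / b) * b = a - `|c| ^+ 2 / b.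
  by rewrite normCK; field; rewrite gt_eqF.
by rewrite subr_ge0 ler_pdivrMr.
Qed.

End Adjoint.

(** * Linear algebra of the boundary forms *)

(* [A] stands for the Gram matrix of the brackets at the endpoint of Q
   sequences, [Phi] for the matrix of their initial values; [U] selects r of
   them. *)
Section BoundaryForm.
Variables (C : numClosedFieldType) (d Q r : nat).
Variables (J : 'M[C]_d) (Phi : 'M[C]_(d, Q)) (A : 'M[C]_Q).
Variables (U : 'M[C]_(r, Q)) (C0 : 'M[C]_(Q, d)).
Hypothesis Aadj : A ^t* = - A.
Hypothesis Gunit : A - Phi ^t* *m J *m Phi \in unitmx.
Hypothesis PhiC0 : Phi *m C0 = 1%:M.
Hypothesis AC0 : A *m C0 = 0.
Hypothesis rE : r = (Q - d)%N.
Hypothesis rankUA : \rank (U *m A) = r.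

Variable Omega : 'M[C]_r.
Hypothesis OmegaE : Omega = U *m A *m U ^t*.

Lemma boundary_dim : (d + r)%N = Q.
Proof. by rewrite rE subnKC // (mulmx1_min PhiC0). Qed.

(** The columns of [C0] are d independent vectors in the kernel of [A], so [A] has rank at most Q -
    d = r. The r independent rows of [U *m A] attain this bound and therefore span the row space of
    [A]. *)
Lemma end_form_factor : exists X, A = X *m (U *m A).
Proof.
apply/submxP; have sUA : (U *m A <= A)%MS by exact: submxMl.
have [le_rk eq_rk] := mxrank_leqif_sup sUA; rewrite -eq_rk eqn_leq le_rk /= rankUA rE.
have rC0 : (d <= \rank C0)%N.
  by have := mxrankM_maxr Phi C0; rewrite PhiC0 mxrank1.
rewrite leq_subRL ?(mulmx1_min PhiC0) // (leq_trans _ (mulmx0_rank_max AC0)) //.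
by rewrite addnC leq_add2l.
Qed.

Lemma end_form_factorr X : A = X *m (U *m A) -> A = A *m U ^t* *m X ^t*.
Proof.
by move=> AX; apply: oppr_inj; rewrite -Aadj {1}AX !adjmxM Aadj !mulNmx.
Qed.

Lemma end_form_hermitian_factor X : A = X *m (U *m A) -> A = X *m Omega *m X ^t*.
Proof.
by move=> AX; rewrite {1}AX {1}(end_form_factorr AX) OmegaE !mulmxA.
Qed.

(** [A] factors through [Omega], so the rank of [Omega] is at least that of [A], hence at least
    r. *)
Lemma Omega_unit : Omega \in unitmx.
Proof.
have [X AX] := end_form_factor; rewrite -row_free_unit /row_free eqn_leq rank_leq_row.
rewrite -{1}rankUA (leq_trans (mxrankM_maxr _ _)) //.
rewrite (end_form_hermitian_factor AX) (leq_trans (mxrankM_maxl _ _)) //.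
exact: mxrankM_maxr.
Qed.

Lemma Omega_adj : Omega ^t* = - Omega.
Proof. by rewrite OmegaE !adjmxM Aadj trmxCK mulNmx mulmxN mulmxA. Qed.

(** The stacked matrix is square by [boundary_dim], so injectivity suffices: a vector killed by
    [Phi] and by [U *m A] is killed by [A], hence by the invertible form of [Gunit]. *)
Lemma boundary_onto p (w : 'M[C]_(d + r, p)) : exists c, col_mx Phi (U *m A) *m c = w.
Proof.
have [X AX] := end_form_factor.
suff /row_freeP[B KB] : row_free (col_mx Phi (U *m A)).
  by exists (B *m w); rewrite mulmxA KB mul1mx.
suff rk : row_free (col_mx Phi (U *m A))^T.
  by move: rk; rewrite /row_free mxrank_tr => /eqP ->; rewrite boundary_dim.
rewrite -kermx_eq0; apply/eqP/row_matrixP => i; rewrite row0.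
set v := row i _; have : v *m (col_mx Phi (U *m A))^T = 0 by rewrite -row_mul mulmx_ker row0.
move=> Kv; have [Phiv UAv] : Phi *m v^T = 0 /\ U *m A *m v^T = 0.
  apply: eq_col_mx; rewrite col_mx0 -mul_col_mx; apply: trmx_inj.
  by rewrite trmx_mul trmxK trmx0.
apply: trmx_inj; rewrite trmx0 -[LHS](mulKmx Gunit) mulmxBl.
by rewrite AX -!mulmxA Phiv !mulmx0 (mulmxA U) UAv mulmx0 subrr mulmx0.
Qed.

(** With A = X Omega X^* and U A = Omega X^*, the endpoint part c^* A e depends on c and e only
    through U A c and U A e. The minus sign in front of the inverse of [Omega] is that of Omega^* =
    - Omega. *)
Lemma boundary_formE p p' (c : 'M[C]_(Q, p)) (e : 'M[C]_(Q, p')) :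
  c ^t* *m (A - Phi ^t* *m J *m Phi) *m e =
  - (U *m A *m c) ^t* *m invmx Omega *m (U *m A *m e)
  - (Phi *m c) ^t* *m J *m (Phi *m e).
Proof.
have [X AX] := end_form_factor; have AOm := end_form_hermitian_factor AX.
have UAOm : U *m A = Omega *m X ^t*.
  by rewrite {1}(end_form_factorr AX) OmegaE !mulmxA.
rewrite mulmxBr mulmxBl; congr (_ - _); last by rewrite adjmxM !mulmxA.
rewrite UAOm {1}AOm (adjmxM (Omega *m _)) (adjmxM Omega) Omega_adj trmxCK.
rewrite !(mulmxN, mulNmx) opprK.
by rewrite -!mulmxA mulKmx ?Omega_unit.
Qed.

End BoundaryForm.

(** * Subspaces equal to their own orthogonal for a skew-hermitian form *)

Section Lagrangian.
Variables (C : numClosedFieldType) (q Q : nat) (B : 'M[C]_Q).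
Hypothesis QE : Q = (q + q)%N.
Hypothesis Badj : B ^t* = - B.
Hypothesis Bunit : B \in unitmx.

Lemma form_adj p p' (v : 'M[C]_(Q, p)) (w : 'M[C]_(Q, p')) :
  v ^t* *m B *m w = - (B *m v) ^t* *m w.
Proof. by rewrite adjmxM Badj mulmxN opprK. Qed.

(** The isotropy condition puts the image of W = B^{-1} K^* inside the kernel of K, and both have
    dimension q = Q - q. So the kernel consists of the vectors W x, and v^* B W x = (K v)^* x. *)
Lemma lagrangian_of_kernel (K : 'M[C]_(q, Q)) (w : 'cV[C]_Q) :
  \rank K = q -> K *m invmx B *m K ^t* = 0 ->
  (K *m w = 0 <-> forall v : 'cV[C]_Q, K *m v = 0 -> v ^t* *m B *m w = 0).
Proof.
move=> rK KBK; pose W := invmx B *m K ^t*.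
have KW : K *m W = 0 by rewrite mulmxA.
have BW : B *m W = K ^t* by rewrite mulKVmx.
have ker_im w' : K *m w' = 0 -> exists x, w' = W *m x.
  move=> Kw; suff /submxP[x xE] : (w'^T <= W^T)%MS.
    by exists x^T; apply: trmx_inj; rewrite trmx_mul trmxK.
  have sub1 : (W^T <= kermx K^T)%MS by apply/sub_kermxP; rewrite -trmx_mul KW trmx0.
  have [_ e] := mxrank_leqif_sup sub1.
  have : (kermx K^T <= W^T)%MS.
    rewrite -e mxrank_ker [\rank K^T]mxrank_tr rK trmx_mul mxrankMfree.
      by rewrite mxrank_tr mxrank_map mxrank_tr rK QE addnK.
    by rewrite row_free_unit unitmx_tr unitmx_inv.
  by apply: submx_trans; apply/sub_kermxP; rewrite -trmx_mul Kw trmx0.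
clearbody W; split=> [/ker_im[x ->] v Kv|vBw].
  by rewrite -!mulmxA (mulmxA B) BW mulmxA -adjmxM Kv adjmx0 mul0mx.
apply: adjmx_mul_eq0.
(* The test vector W K w lies in the kernel and pairs with w to minus the squared norm of K w. *)
have : K *m (W *m (K *m w)) = 0 by rewrite mulmxA KW mul0mx.
move=> /vBw; rewrite form_adj (mulmxA B) BW adjmxM trmxCK mulNmx -mulmxA => /eqP.
by rewrite oppr_eq0 => /eqP.
Qed.

(** Among the matrices whose rows lie in the subspace, one of maximal rank spans it: adjoining a
    further vector of the subspace cannot raise the rank. *)
Lemma subspace_basis (V : set 'cV[C]_Q) :
    V 0 -> (forall a v v', V v -> V v' -> V (a *: v + v')) ->
  exists k (R : 'M[C]_(Q, k)), \rank R = k /\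
    forall w, V w <-> exists x, w = R *m x.
Proof.
move=> V0 Vlin.
pose inV p (M : 'M[C]_(p, Q)) := forall y : 'rV[C]_p, V (y *m M)^T.
pose P k := `[< exists M : 'M[C]_Q, inV _ M /\ \rank M = k >].
have exP : exists k, P k.
  exists 0%N; apply/asboolP; exists 0; split; last exact: mxrank0.
  by move=> y; rewrite mulmx0 trmx0.
have bndP k : P k -> (k <= Q)%N by move=> /asboolP[M [_ <-]]; exact: rank_leq_row.
case: (ex_maxnP exP bndP) => k /asboolP[M [VM rM]] kmax.
exists (\rank M), (row_base M)^T; split.
  by rewrite mxrank_tr; apply/eqP; exact: row_base_free.
have sub w : V w <-> (w^T <= M)%MS.
  split=> [Vw|/submxP[x xE]]; last by rewrite -[w]trmxK xE.
  have : P (\rank (M + w^T)%MS).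
    apply/asboolP; exists (M + w^T)%MS; split => // y.
    have /sub_addsmxP[[u1 u2] /= ->] := submxMl y (M + w^T)%MS.
    rewrite linearD /= addrC trmx_mul trmxK [u2]mx11_scalar tr_scalar_mx mul_mx_scalar.
    by apply: Vlin.
  move=> /kmax; rewrite -rM => le_rk.
  have [_ e] := mxrank_leqif_sup (addsmxSl M w^T).
  apply: submx_trans (addsmxSr M w^T) _; rewrite -e eqn_leq le_rk andbT.
  exact/mxrankS/addsmxSl.
move=> w; rewrite sub -(eq_row_base M).
split=> [/submxP[x xE]|[x ->]]; last by rewrite trmx_mul trmxK submxMl.
by exists x^T; rewrite -trmx_mul -xE trmxK.
Qed.

(** For a basis matrix R of V, take K = R^* B: the kernel of K is the orthogonal of V, that is V.
    Comparing dimensions gives k = Q - k, and K B^{-1} K^* = - K R = 0. *)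
Lemma kernel_of_lagrangian (V : set 'cV[C]_Q) :
    V 0 -> (forall a v v', V v -> V v' -> V (a *: v + v')) ->
    (forall w, V w <-> forall v, V v -> v ^t* *m B *m w = 0) ->
  exists K : 'M[C]_(q, Q),
    [/\ \rank K = q, K *m invmx B *m K ^t* = 0 & forall w, V w <-> K *m w = 0].
Proof.
move=> V0 Vlin VV; have [k [R [rR VR]]] := subspace_basis V0 Vlin.
pose K := R ^t* *m B.
have VK w : V w <-> K *m w = 0.
  rewrite VV; split=> [vBw|Kw v /VR[x ->]].
    have [y yE] : exists y, y = K *m w by exists (K *m w).
    rewrite -yE; apply: adjmx_mul_eq0; rewrite {2}yE /K -mulmxA mulmxA -adjmxM mulmxA.
    by apply: vBw; apply/VR; exists y.
  by rewrite adjmxM -!mulmxA (mulmxA _ B) -/K Kw mulmx0.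
have KR : K *m R = 0.
  apply/matrixP => i j.
  have : K *m (R *m delta_mx j (0 : 'I_1)) = 0 by apply/VK/VR; eexists.
  by rewrite mulmxA -colE => /matrixP/(_ i 0); rewrite [LHS]mxE => ->; rewrite !mxE.
have rK : \rank K = k.
  by rewrite mxrankMfree ?row_free_unit // mxrank_map mxrank_tr.
have kq : k = q.
  have sub1 : (R^T <= kermx K^T)%MS by apply/sub_kermxP; rewrite -trmx_mul KR trmx0.
  have sub2 : (kermx K^T <= R^T)%MS.
    apply/row_subP => i.
    have /VR[x xE] : V (row i (kermx K^T))^T.
      by apply/VK/trmx_inj; rewrite trmx_mul trmxK trmx0 -row_mul mulmx_ker row0.
    by rewrite -[row i _]trmxK xE trmx_mul submxMl.
  have : \rank R^T = \rank (kermx K^T) by apply/eqP; rewrite eqn_leq !mxrankS.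
  rewrite mxrank_ker !mxrank_tr rR rK => kE.
  have kQ : (k <= Q)%N by rewrite -rR rank_leq_row.
  have : (k + k)%N = Q by rewrite {2}kE subnKC.
  by rewrite QE !addnn => /double_inj.
rewrite -kq; exists K; split=> //.
rewrite /K adjmxM trmxCK Badj mulNmx mulmxN -!mulmxA (mulmxA B) mulmxV // mul1mx.
by rewrite mulmxA -/K KR oppr0.
Qed.

End Lagrangian.

(** * Limits of complex matrices *)

Section MatrixLimits.
Variable C : numClosedFieldType.

Lemma cvg_conjC (u : nat -> C) (l : C) :
  u @ \oo --> l -> (fun m => (u m)^*) @ \oo --> l^*.
Proof.
move=> /cvgrPdist_le ul; apply/cvgrPdist_le => e e0.
by near=> m; rewrite -rmorphB norm_conjC; near: m; exact: ul.
Unshelve. all: by end_near. Qed.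

(** The order being partial, nonnegativity is expressed as u = |u|, an equation that passes to the
    limit. *)
Lemma cvg_ge0C (u : nat -> C) (l : C) :
  u @ \oo --> l -> (\forall m \near \oo, 0 <= u m) -> 0 <= l.
Proof.
move=> ul u0; have nl : (fun m => `|u m|) @ \oo --> `|l| by exact: cvg_norm.
suff -> : l = `|l| by exact: normr_ge0.
apply: (cvg_unique _ ul) => //.
apply: cvg_trans nl; apply: near_eq_cvg; near=> m.
by rewrite ger0_norm //; near: m.
Unshelve. all: by end_near. Qed.

Lemma cvg_leC (u v : nat -> C) (l k : C) : u @ \oo --> l -> v @ \oo --> k ->
  (\forall m \near \oo, u m <= v m) -> l <= k.
Proof.
move=> ul vk uv; rewrite -subr_ge0; apply: (cvg_ge0C (cvgB vk ul)).
by near=> m; rewrite subr_ge0; near: m.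
Unshelve. all: by end_near. Qed.

Definition mxcvg p r (u : nat -> 'M[C]_(p, r)) (l : 'M[C]_(p, r)) : Prop :=
  forall i j, (fun m => u m i j : C) @ \oo --> (l i j : C).

Lemma mxcvg_unique p r (u : nat -> 'M[C]_(p, r)) l l' :
  mxcvg u l -> mxcvg u l' -> l = l'.
Proof.
by move=> ul ul'; apply/matrixP => i j; exact: (cvg_unique _ (ul i j) (ul' i j)).
Qed.

Lemma mxcvg_near p r (u v : nat -> 'M[C]_(p, r)) l :
  (\forall m \near \oo, u m = v m) -> mxcvg u l -> mxcvg v l.
Proof.
move=> uv ul i j; apply: cvg_trans (ul i j); apply: near_eq_cvg; near=> m.
by have -> : u m = v m by near: m.
Unshelve. all: by end_near. Qed.

Lemma mxcvg_cst p r (l : 'M[C]_(p, r)) : mxcvg (fun=> l) l.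
Proof. by move=> i j; exact: cvg_cst. Qed.

Lemma mxcvgD p r (u v : nat -> 'M[C]_(p, r)) l k :
  mxcvg u l -> mxcvg v k -> mxcvg (fun m => u m + v m) (l + k).
Proof.
move=> ul vk i j; rewrite mxE; under eq_fun do rewrite mxE.
exact: cvgD.
Qed.

Lemma mxcvgN p r (u : nat -> 'M[C]_(p, r)) l :
  mxcvg u l -> mxcvg (fun m => - u m) (- l).
Proof.
move=> ul i j; rewrite mxE; under eq_fun do rewrite mxE.
exact: cvgN.
Qed.

Lemma mxcvgB p r (u v : nat -> 'M[C]_(p, r)) l k :
  mxcvg u l -> mxcvg v k -> mxcvg (fun m => u m - v m) (l - k).
Proof. by move=> ul vk; apply/mxcvgD => //; exact: mxcvgN. Qed.

Lemma mxcvgM p r s (u : nat -> 'M[C]_(p, r)) (v : nat -> 'M[C]_(r, s)) l k :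
  mxcvg u l -> mxcvg v k -> mxcvg (fun m => u m *m v m) (l *m k).
Proof.
move=> ul vk i j; rewrite mxE; under eq_fun do rewrite mxE.
by apply: cvg_big => [|t _]; [exact: add_continuous | exact: cvgM].
Qed.

Lemma mxcvg_adj p r (u : nat -> 'M[C]_(p, r)) l :
  mxcvg u l -> mxcvg (fun m => (u m) ^t*) (l ^t*).
Proof.
move=> ul i j; rewrite !mxE; under eq_fun do rewrite !mxE.
exact: cvg_conjC.
Qed.

End MatrixLimits.

(** * Cauchy and monotone sequences of complex numbers *)

Section ComplexCompleteness.
Variable R : realType.
Local Notation C := (CC R).

Lemma normC_le_ReIm (x : C) :
  `|x| <= (`|complex.Re x| + `|complex.Im x|)%:C%C.
Proof.
have x2 := add_Re2_Im2 x; have n0 : 0 <= `|complex.Re x| + `|complex.Im x| by rewrite addr_ge0.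
rewrite -(ler_pXn2r (ltn0Sn 1)) ?nnegrE ?normr_ge0 ?ler0c //.
rewrite -[leLHS]x2 -rmorphXn lecR sqrrD !real_normK ?num_real // addrAC lerDl.
by rewrite mulrn_wge0 // mulr_ge0.
Qed.

Lemma cvgC_ReIm (u : nat -> C) (a b : R) :
  (fun m => complex.Re (u m)) @ \oo --> a -> (fun m => complex.Im (u m)) @ \oo --> b ->
  u @ \oo --> ((a +i* b)%C : C).
Proof.
move=> /cvgrPdist_le ua /cvgrPdist_le ub; apply/cvgrPdist_le => e e0.
have [r r0 re] : exists2 r : R, 0 < r & (r + r)%:C%C = e.
  exists (complex.Re e / 2).
    by move: e0; rewrite ltcE => /andP[_ /= h]; rewrite divr_gt0.
  by rewrite -splitr RRe_real // gtr0_real.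
near=> m; apply: le_trans (normC_le_ReIm _) _; rewrite -re lecR lerD //.
- have -> : complex.Re ((a +i* b)%C - u m) = a - complex.Re (u m) by case: (u m).
  by near: m; exact: ua.
- have -> : complex.Im ((a +i* b)%C - u m) = b - complex.Im (u m) by case: (u m).
  by near: m; exact: ub.
Unshelve. all: by end_near. Qed.

(** This and [nondecreasing_cvgC] discharge the two completeness hypotheses under which the system
    is studied over an abstract closed field. *)
Lemma cauchy_cvgC (u : nat -> C) :
    (forall e : C, 0 < e -> exists m0, forall m m', (m0 <= m)%N -> (m <= m')%N ->
       `|u m' - u m| <= e) -> cvgn u.
Proof.
move=> uc.
have part (f : C -> R) : (forall x y, `|f x - f y|%:C%C <= `|x - y|) ->
    cvgn (fun m => f (u m)).
  move=> fle; apply/cauchy_cvgP/cauchy_exP => e e0.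
  have [|m0 um0] := uc (e / 2)%:C%C; first by rewrite ltcR divr_gt0.
  exists (f (u m0)), m0 => // m /= mm0; rewrite /ball /= distrC.
  have := le_trans (fle _ _) (um0 m0 m (leqnn _) mm0).
  by rewrite lecR => /le_lt_trans; apply; rewrite ltr_pdivrMr // ltr_pMr // ltr1n.
have /cvg_ex[a ua] : cvgn (fun m => complex.Re (u m)).
  apply: part => x y; apply: le_trans (normc_ge_Re _).
  by case: x y => [? ?] [? ?].
have /cvg_ex[b ub] : cvgn (fun m => complex.Im (u m)).
  apply: part => x y; have := normc_ge_Re ((x - y) * 'i%C).
  rewrite ReiNIm normrN normrM complexiE normCi mulr1; apply: le_trans.
  by case: x y => [? ?] [? ?].
by apply/cvg_ex; eexists; exact: cvgC_ReIm ua ub.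
Qed.

(** Comparable complex numbers have the same imaginary part, so only the real part moves. *)
Lemma nondecreasing_cvgC (u : nat -> C) (K : C) :
  (forall m, u m <= u m.+1) -> (forall m, u m <= K) -> cvgn u.
Proof.
move=> und uK.
have /cvg_ex[a ua] : cvgn (fun m => complex.Re (u m)).
  apply: nondecreasing_is_cvgn.
    by apply/nondecreasing_seqP => m; have := und m; rewrite lecE => /andP[].
  by exists (complex.Re K) => _ [m _ <-]; have := uK m; rewrite lecE => /andP[].
have ub : (fun m => complex.Im (u m)) @ \oo --> complex.Im K.
  have -> : (fun m => complex.Im (u m)) = (fun=> complex.Im K).
    by apply/funext => m; have := uK m; rewrite lecE => /andP[/eqP].
  exact: cvg_cst.
by apply/cvg_ex; eexists; exact: cvgC_ReIm ua ub.
Qed.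

End ComplexCompleteness.

(** * Discrete symplectic systems on all of nat *)

Section System.
Variables (C : numClosedFieldType) (d : nat).
Variables (J : 'M[C]_d) (S Psi : nat -> 'M[C]_d).
Hypothesis JJ : J *m J = - 1%:M.
Hypothesis Jadj : J ^t* = - J.
Hypothesis Ssympl : forall k, (S k) ^t* *m J *m S k = J.
Hypothesis Psi_adj : forall k, (Psi k) ^t* = Psi k.
Hypothesis Psi_iso : forall k, Psi k *m J *m Psi k = 0.
Hypothesis Psi_ge0 : forall k (v : 'cV[C]_d), 0 <= (v ^t* *m Psi k *m v) 0 0.

Local Notation mseq p := (nat -> 'M[C]_(d, p)).

Definition mulr_mseq p r (A : mseq p) (c : 'M[C]_(p, r)) : mseq r :=
  fun k => A k *m c.
Local Notation "A **m c" := (mulr_mseq A c) (at level 40, left associativity).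

Definition jform p r (A : mseq p) (B : mseq r) (k : nat) : 'M[C]_(p, r) :=
  (A k) ^t* *m J *m B k.

Definition ip (m : nat) p r (A : mseq p) (B : mseq r) : 'M[C]_(p, r) :=
  \sum_(k < m) (A k) ^t* *m Psi k *m B k.

(* The equation [L A = Psi F], solved for [S k *m A k.+1]. *)
Definition sys p (A F : mseq p) : Prop :=
  forall k, S k *m A k.+1 = A k + J *m Psi k *m F k.

Lemma ipDl m p r (A A' : mseq p) (B : mseq r) :
  ip m (A + A') B = ip m A B + ip m A' B.
Proof.
rewrite /ip -big_split; apply: eq_bigr => k _ /=.
by rewrite adjmxD !mulmxDl.
Qed.

Lemma ip0l m p r (B : mseq r) : ip m (0 : mseq p) B = 0.
Proof. by apply: (addIr (ip m 0 B)); rewrite add0r -ipDl addr0. Qed.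

Lemma ipDr m p r (A : mseq p) (B B' : mseq r) :
  ip m A (B + B') = ip m A B + ip m A B'.
Proof. by rewrite /ip -big_split; apply: eq_bigr => k _; rewrite mulmxDr. Qed.

Lemma ipMl m p p' r (A : mseq p) (c : 'M[C]_(p, p')) (B : mseq r) :
  ip m (A **m c) B = c ^t* *m ip m A B.
Proof.
rewrite /ip mulmx_sumr; apply: eq_bigr => k _.
by rewrite adjmxM !mulmxA.
Qed.

Lemma ipMr m p r r' (A : mseq p) (B : mseq r) (c : 'M[C]_(r, r')) :
  ip m A (B **m c) = ip m A B *m c.
Proof.
by rewrite /ip mulmx_suml; apply: eq_bigr => k _; rewrite !mulmxA.
Qed.

Lemma mseqMB p r (A : mseq p) (c e : 'M[C]_(p, r)) : A **m (c - e) = A **m c - A **m e.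
Proof. by apply/funext => k; exact: mulmxBr. Qed.

Lemma ipZl m p r a (A : mseq p) (B : mseq r) :
  ip m (a *: A) B = a^* *: ip m A B.
Proof.
rewrite /ip scaler_sumr; apply: eq_bigr => k _.
by rewrite adjmxZ -!scalemxAl.
Qed.

Lemma ipZr m p r a (A : mseq p) (B : mseq r) :
  ip m A (a *: B) = a *: ip m A B.
Proof.
by rewrite /ip scaler_sumr; apply: eq_bigr => k _; rewrite -scalemxAr.
Qed.

Lemma ipNl m p r (A : mseq p) (B : mseq r) : ip m (- A) B = - ip m A B.
Proof. by rewrite -scaleN1r ipZl rmorphN1 scaleN1r. Qed.

Lemma ipNr m p r (A : mseq p) (B : mseq r) : ip m A (- B) = - ip m A B.
Proof. by rewrite -scaleN1r ipZr scaleN1r. Qed.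

Lemma ipBl m p r (A A' : mseq p) (B : mseq r) :
  ip m (A - A') B = ip m A B - ip m A' B.
Proof. by rewrite ipDl ipNl. Qed.

Lemma ipBr m p r (A : mseq p) (B B' : mseq r) :
  ip m A (B - B') = ip m A B - ip m A B'.
Proof. by rewrite ipDr ipNr. Qed.

Lemma ip_adj m p r (A : mseq p) (B : mseq r) : (ip m A B) ^t* = ip m B A.
Proof.
rewrite /ip adjmx_sum; apply: eq_bigr => k _.
by rewrite !adjmxM trmxCK Psi_adj mulmxA.
Qed.

Lemma ipS m p r (A : mseq p) (B : mseq r) :
  ip m.+1 A B = ip m A B + (A m) ^t* *m Psi m *m B m.
Proof. by rewrite /ip big_ord_recr. Qed.

Lemma eq_ip m p r (A A' : mseq p) (B B' : mseq r) :
    (forall k, (k < m)%N -> A k = A' k) -> (forall k, (k < m)%N -> B k = B' k) ->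
  ip m A B = ip m A' B'.
Proof. by move=> eA eB; apply: eq_bigr => k _; rewrite eA ?eB. Qed.

Lemma ip_stable m m' p r (A : mseq p) (B : mseq r) : (m <= m')%N ->
    (forall k, (m <= k)%N -> Psi k *m B k = 0) ->
  ip m' A B = ip m A B.
Proof.
move=> mm' B0; rewrite -(subnKC mm'); elim: (m' - m)%N => [|j IH]; first by rewrite addn0.
by rewrite addnS ipS IH -mulmxA B0 ?mulmx0 ?addr0 ?leq_addr.
Qed.

Lemma ip_ge0 m (x : mseq 1) : 0 <= ip m x x 0 0.
Proof. by rewrite /ip summxE sumr_ge0 // => k _; exact: Psi_ge0. Qed.

Lemma ip_le m m' (x : mseq 1) : (m <= m')%N -> ip m x x 0 0 <= ip m' x x 0 0.
Proof.
move=> mm'; rewrite -(subnKC mm'); elim: (m' - m)%N => [|j IH]; first by rewrite addn0.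
by rewrite addnS ipS [leRHS]mxE (le_trans IH)// lerDl Psi_ge0.
Qed.

Lemma ip_eq0C m p r (A : mseq p) (B : mseq r) : ip m A B = 0 -> ip m B A = 0.
Proof. by move=> AB; rewrite -ip_adj AB adjmx0. Qed.

Lemma ipC m (x y : mseq 1) : ip m x y 0 0 = (ip m y x 0 0)^*.
Proof. by rewrite -(ip_adj m y x) !mxE. Qed.

Lemma ip_cauchy_schwarz m (x y : mseq 1) :
  `|ip m x y 0 0| ^+ 2 <= ip m x x 0 0 * ip m y y 0 0.
Proof.
apply: discriminant_le; rewrite ?ip_ge0 // => t.
have := ip_ge0 m (x - t *: y); rewrite ipBl !ipBr !ipZl !ipZr.
rewrite !mxE (ipC m y x); congr (0 <= _); ring.
Qed.

(** Lagrange's identity. Symplecticity inserts [S m] on both sides of the bracket at m + 1; after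
    expansion the term with two factors Psi vanishes by isotropy. *)
Lemma green p r (A F : mseq p) (B G : mseq r) m : sys A F -> sys B G ->
  jform A B m = jform A B 0 + ip m F B - ip m A G.
Proof.
move=> sA sB; elim: m => [|m IH]; first by rewrite /ip !big_ord0 addr0 subr0.
have -> : jform A B m.+1 = (S m *m A m.+1) ^t* *m J *m (S m *m B m.+1).
  by rewrite /jform -{1}(Ssympl m) adjmxM !mulmxA.
rewrite sA sB !ipS; move: IH; rewrite /jform.
move: (A m) (B m) (F m) (G m) (Psi_adj m) (Psi_iso m) => a b f g.
move: (Psi m) => P Pa Pi IH.
have JJl s (x : 'M[C]_(d, s)) : J *m (J *m x) = - x by rewrite mulmxA JJ mulNmx mul1mx.
have PJP s (x : 'M[C]_(d, s)) : P *m (J *m (P *m x)) = 0.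
  by rewrite !mulmxA Pi mul0mx.
rewrite adjmxD !adjmxM Pa Jadj !(mulmxDl, mulmxDr) IH.
rewrite -!mulmxA !(mulNmx, mulmxN, JJl, PJP, oppr0, mulmx0) !(mulNmx, mulmxN, opprK, addr0).
rewrite opprD -!addrA; congr (_ + (_ + _)); rewrite addrCA; congr (_ + _).
Qed.

Lemma sysM p r (A F : mseq p) (c : 'M[C]_(p, r)) : sys A F -> sys (A **m c) (F **m c).
Proof. by move=> sA k; rewrite /mulr_mseq mulmxA sA mulmxDl -!mulmxA. Qed.

Lemma sysD p (A F B G : mseq p) : sys A F -> sys B G -> sys (A + B) (F + G).
Proof. by move=> sA sB k; rewrite !mulmxDr sA sB addrACA. Qed.

Lemma sysZ p a (A F : mseq p) : sys A F -> sys (a *: A) (a *: F).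
Proof. by move=> sA k; rewrite -!scalemxAr sA -scalerDr. Qed.

Lemma sysB p (A F B G : mseq p) : sys A F -> sys B G -> sys (A - B) (F - G).
Proof. by move=> sA sB; rewrite -(scaleN1r B) -(scaleN1r G); apply/sysD/sysZ. Qed.

Lemma eq_sys p (A F F' : mseq p) : (forall k, Psi k *m F k = Psi k *m F' k) ->
  sys A F -> sys A F'.
Proof. by move=> eF sA k; rewrite sA -!mulmxA eF. Qed.

(** The inverse of a symplectic matrix, read off from S^* J S = J and J^2 = -1. *)
Definition Sinv k : 'M[C]_d := - (J *m (S k) ^t* *m J).

Lemma SinvK k : Sinv k *m S k = 1%:M.
Proof. by rewrite /Sinv mulNmx -!mulmxA (mulmxA _ J) Ssympl JJ opprK. Qed.

Lemma sys_next p (A F : mseq p) k : sys A F ->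
  A k.+1 = Sinv k *m (A k + J *m Psi k *m F k).
Proof. by move=> <-; rewrite mulmxA SinvK mul1mx. Qed.

Lemma sys_inj p lam (F A B : mseq p) m k :
    sys A (lam *: A + F) -> sys B (lam *: B + F) -> A m = B m ->
  (m <= k)%N -> A k = B k.
Proof.
move=> sA sB eAB /subnKC <-; elim: (k - m)%N => [|j IH]; first by rewrite addn0.
by rewrite addnS (sys_next _ sA) (sys_next _ sB) -[(_ *: A + _) _]/(_ *: A _ + _) IH.
Qed.

Lemma sys_vanish p (A F : mseq p) m k : sys A F -> A m = 0 ->
  (forall j, (m <= j)%N -> F j = 0) -> (m <= k)%N -> A k = 0.
Proof.
move=> sA Am F0 /subnKC <-; elim: (k - m)%N => [|j IH]; first by rewrite addn0.
by rewrite addnS (sys_next _ sA) IH F0 ?leq_addr // mulmx0 addr0 mulmx0.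
Qed.

(** The solution of L A = Psi (lam A + F) with initial value [A0]. The right-hand side involves the
    sequence at index k only, so the recursion runs forward explicitly. *)
Fixpoint propagate p lam (F : mseq p) (A0 : 'M[C]_(d, p)) k : 'M[C]_(d, p) :=
  if k is j.+1 then
    let A := propagate lam F A0 j in Sinv j *m (A + J *m Psi j *m (lam *: A + F j))
  else A0.

Lemma propagate_sys p lam (F : mseq p) A0 :
  sys (propagate lam F A0) (lam *: propagate lam F A0 + F).
Proof. by move=> k /=; rewrite mulmxA (mulmx1C (SinvK k)) mul1mx. Qed.

Definition fundsol lam : mseq d := propagate lam 0 1%:M.
Local Notation Theta := fundsol.

Lemma fundsol_sys lam : sys (Theta lam) (lam *: Theta lam).
Proof. by have := propagate_sys lam 0 1%:M; rewrite addr0. Qed.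

Lemma fundsolE p lam (A : mseq p) : sys A (lam *: A) -> A = Theta lam **m A 0%N.
Proof.
move=> sA; apply/funext => k.
apply: (@sys_inj _ lam 0 _ _ 0) => //; rewrite ?addr0 // /mulr_mseq ?mul1mx //.
by have := sysM (A 0) (fundsol_sys lam); congr (sys _ _); apply/funext => j;
  rewrite /mulr_mseq -scalemxAl.
Qed.

Lemma sys_fundsolM p lam (c : 'M[C]_(d, p)) :
  sys (Theta lam **m c) (lam *: (Theta lam **m c)).
Proof.
have := sysM c (fundsol_sys lam); congr (sys _ _); apply/funext => j.
by rewrite /mulr_mseq -scalemxAl.
Qed.

(** The bracket of the fundamental matrices for conj lam and for lam is constantly J, because the
    two sums in Lagrange's identity cancel. *)
Lemma fundsol_unit lam m : Theta lam m \in unitmx.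
Proof.
have := green m (fundsol_sys lam^*) (fundsol_sys lam).
rewrite ipZl ipZr conjCK addrK {2}/jform /= adjmx1 mulmx1 mul1mx => e.
have : (- J *m (Theta lam^* m)^t* *m J) *m Theta lam m = 1%:M.
  by rewrite -!mulmxA mulNmx (mulmxA _ J) -/(jform _ _ _) e JJ opprK.
by case/mulmx1_unit.
Qed.

Lemma J_unit : J \in unitmx.
Proof.
by have : (- J) *m J = 1%:M by [rewrite mulNmx JJ opprK]; case/mulmx1_unit.
Qed.

Lemma fundsol_adjJ_inj lam m p (v : 'M[C]_(d, p)) :
  (Theta lam m)^t* *m J *m v = 0 -> v = 0.
Proof.
have U : (Theta lam m)^t* *m J \in unitmx.
  by rewrite unitmx_mul J_unit map_unitmx unitmx_tr fundsol_unit.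
by move=> h; rewrite -[v](mulKmx U) h mulmx0.
Qed.

Variable b : nat.
Hypothesis definite : forall lam (s : mseq 1), sys s (lam *: s) -> s 0%N != 0 ->
  0 < ip b s s 0 0.

Definition gram lam m := ip m (Theta lam) (Theta lam).

Lemma gram_unit lam m : (b <= m)%N -> gram lam m \in unitmx.
Proof.
move=> bm; apply: unitmx_inj => v Gv; apply/eqP/negPn/negP => v0.
have s0 : (Theta lam **m v) 0%N = v by rewrite /mulr_mseq mul1mx.
have := definite (sys_fundsolM lam v); rewrite s0 => /(_ v0) h.
have := lt_le_trans h (ip_le _ bm); rewrite ipMr ipMl -mulmxA -/(gram _ _) Gv.
by rewrite mulmx0 mxE ltxx.
Qed.

Definition cut m p (F : mseq p) : mseq p := fun k => if (k < m)%N then F k else 0.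

Lemma ip_cutr m m' p r (A : mseq p) (B : mseq r) : (m <= m')%N ->
  ip m' A (cut m B) = ip m A B.
Proof.
move=> mm'; rewrite (ip_stable _ mm') => [|k mk].
  by apply: eq_ip => // k km; rewrite /cut km.
by rewrite /cut ltnNge mk mulmx0.
Qed.

Lemma ip_cutl m m' p r (A : mseq p) (B : mseq r) : (m <= m')%N ->
  ip m' (cut m A) B = ip m A B.
Proof. by move=> mm'; rewrite -ip_adj ip_cutr // ip_adj. Qed.

(** The right-hand side is sought among the solutions of L z = 0 cut off at b. Lagrange's identity
    against these solutions turns A b = 0 into a linear system for the coefficients, with the
    invertible Gram matrix. *)
Lemma start_free p (A0 : 'M[C]_(d, p)) : exists A F : mseq p,
  [/\ sys A F, A 0%N = A0 & forall k, (b <= k)%N -> A k = 0 /\ F k = 0].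
Proof.
pose F := cut b (Theta 0 **m (invmx (gram 0 b) *m (J *m A0))).
pose A := propagate 0 F A0.
have sA : sys A F by have := propagate_sys 0 F A0; rewrite scale0r add0r.
exists A, F; split => // k bk; split; last by rewrite /F /cut ltnNge bk.
have sT : sys (Theta 0) 0 by have := fundsol_sys 0; rewrite scale0r.
have Ab : A b = 0.
  have := green b sT sA; rewrite ip0l addr0.
  rewrite /F ip_cutr // ipMr -/(gram _ _) mulKVmx ?gram_unit //.
  rewrite {2}/jform /= adjmx1 mul1mx subrr.
  exact: fundsol_adjJ_inj.
apply: sys_vanish sA Ab _ bk => j bj; by rewrite /F /cut ltnNge bj.
Qed.

(* Test sequences: a point mass at [k], made orthogonal to the solutions of
   [L z = 0] by subtracting such a solution cut off at [b]. *)
Lemma adjoint_minimal (y w g : mseq 1) : sys w g ->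
    (forall (z f : mseq 1) m, sys z f -> z 0%N = 0 ->
       (forall k, (m <= k)%N -> z k = 0 /\ f k = 0) -> ip m z g = ip m f y) ->
  exists c : 'cV[C]_d, forall k, Psi k *m (w k + Theta 0 k *m c) = Psi k *m y k.
Proof.
move=> sw orth.
have sT : sys (Theta 0) 0 by have := fundsol_sys 0; rewrite scale0r.
have Gu := gram_unit 0 (leqnn b).
(* This choice makes [h] orthogonal over [0, b) to all solutions of L z = 0, so that the correction
   term in the test sequence [f] does not contribute to its pairing with [h]. *)
pose c := invmx (gram 0 b) *m ip b (Theta 0) (y - w).
pose h := y - w - Theta 0 **m c.
have Th0 : ip b (Theta 0) h = 0.
  by rewrite ipBr ipMr -/(gram _ _) mulKVmx // subrr.
exists c => k; apply/eqP; rewrite -subr_eq0 -mulmxBr -opprB mulmxN oppr_eq0; apply/eqP.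
have -> : y k - (w k + Theta 0 k *m c) = h k by rewrite opprD addrA.
suff xi0 (xi : 'cV_d) : xi^t* *m (Psi k *m h k) = 0.
  by apply: adjmx_mul_eq0; exact: xi0.
pose D := invmx (gram 0 b) *m ((Theta 0 k)^t* *m Psi k *m xi).
pose m := maxn k.+1 b; have bm : (b <= m)%N by rewrite leq_maxr.
have km : (k < m)%N by rewrite leq_max leqnn.
pose del : mseq 1 := fun j => if j == k then xi else 0.
have ip_del p (A : mseq p) : ip m A del = (A k)^t* *m Psi k *m xi.
  rewrite /ip (bigD1 (Ordinal km)) //= big1 ?addr0 => [|j jk].
    by rewrite /del eqxx.
  by rewrite /del ifN ?mulmx0.
pose f := del - cut b (Theta 0 **m D).
have f0 j : (m <= j)%N -> f j = 0.
  move=> mj; rewrite /f -[LHS]/(del j - cut b _ j) /cut ltnNge (leq_trans bm mj).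
  by rewrite subr0 /del gtn_eqF // (leq_trans km).
have Tf : ip m (Theta 0) f = 0.
  by rewrite ipBr ip_del ip_cutr // ipMr -/(gram _ _) mulKVmx // subrr.
pose z := propagate 0 f 0.
have sz : sys z f by have := propagate_sys 0 f 0; rewrite scale0r add0r.
have zm : z m = 0.
  have := green m sT sz; rewrite ip0l addr0.
  rewrite Tf subr0 {2}/jform /= mulmx0; exact: fundsol_adjJ_inj.
have z0 j : (m <= j)%N -> z j = 0 by exact: (sys_vanish sz zm f0).
have fh : ip m f h = 0.
  have fy := orth z f m sz erefl (fun j mj => conj (z0 j mj) (f0 j mj)).
  have := green m sz sw; rewrite /jform zm /= adjmx0 !mul0mx add0r fy.
  move=> /esym/eqP; rewrite subr_eq0 => /eqP fw.
  by rewrite !ipBr -fw subrr sub0r ipMr -ip_adj Tf adjmx0 mul0mx oppr0.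
move: fh; rewrite ipBl ip_cutl // ipMl Th0 mulmx0 subr0 -ip_adj ip_del.
move=> /(congr1 (fun M => M^t*)).
by rewrite trmxCK adjmx0 => /(congr1 (fun M => M^t*)); rewrite adjmx0 !adjmxM trmxCK Psi_adj.
Qed.

(** * Square summability and the limit inner product *)

Hypothesis cauchyC : forall u : nat -> C,
  (forall e : C, 0 < e -> exists m0, forall m m', (m0 <= m)%N -> (m <= m')%N ->
     `|u m' - u m| <= e) -> cvgn u.
Hypothesis nondecreasingC : forall (u : nat -> C) (K : C),
  (forall m, u m <= u m.+1) -> (forall m, u m <= K) -> cvgn u.

Definition bounded_norm (x : mseq 1) : Prop :=
  exists K, forall m, ip m x x 0 0 <= K.

(** Stated for all combinations of the columns, which makes it stable under right multiplication. *)
Definition l2 p (A : mseq p) : Prop :=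
  forall v : 'cV[C]_p, bounded_norm (A **m v).

Lemma ip_parallelogram m (x y : mseq 1) :
  ip m (x + y) (x + y) 0 0 + ip m (x - y) (x - y) 0 0 =
  2 * (ip m x x 0 0 + ip m y y 0 0).
Proof. by rewrite !(ipDl, ipNl) !(ipDr, ipNr) !mxE; ring. Qed.

Lemma ipD_le m (x y : mseq 1) :
  ip m (x + y) (x + y) 0 0 <= 2 * (ip m x x 0 0 + ip m y y 0 0).
Proof. by rewrite -ip_parallelogram lerDl ip_ge0. Qed.

Lemma bounded_normD x y : bounded_norm x -> bounded_norm y -> bounded_norm (x + y).
Proof.
move=> [K xK] [L yL]; exists (2 * (K + L)) => m.
by rewrite (le_trans (ipD_le m x y)) // ler_pM2l // lerD.
Qed.

Lemma bounded_normZ a x : bounded_norm x -> bounded_norm (a *: x).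
Proof.
move=> [K xK]; exists (`|a| ^+ 2 * K) => m.
by rewrite ipZl ipZr !mxE mulrA [_^* * a]mulrC -normCK ler_wpM2l // exprn_ge0.
Qed.

Lemma mseqM1 (x : mseq 1) (v : 'cV[C]_1) : x **m v = v 0 0 *: x.
Proof.
apply/funext => k; rewrite /mulr_mseq [v]mx11_scalar mul_mx_scalar.
by rewrite !mxE eqxx mulr1n.
Qed.

Lemma l2_vec (x : mseq 1) : l2 x <-> bounded_norm x.
Proof.
split=> [/(_ 1%:M)|x2 v]; last by rewrite mseqM1; exact: bounded_normZ.
by rewrite mseqM1 mxE eqxx scale1r.
Qed.

Lemma l2D p (A B : mseq p) : l2 A -> l2 B -> l2 (A + B).
Proof.
move=> A2 B2 v; have -> : (A + B) **m v = A **m v + B **m v.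
  by apply/funext => k; exact: mulmxDl.
exact: bounded_normD.
Qed.

Lemma l2Z p a (A : mseq p) : l2 A -> l2 (a *: A).
Proof.
move=> A2 v; have -> : (a *: A) **m v = a *: (A **m v).
  by apply/funext => k; rewrite /mulr_mseq -scalemxAl.
exact: bounded_normZ.
Qed.

Lemma l2B p (A B : mseq p) : l2 A -> l2 B -> l2 (A - B).
Proof. by move=> A2 B2; rewrite -(scaleN1r B); apply/l2D/l2Z. Qed.

Lemma mseqMA p r s (A : mseq p) (c : 'M[C]_(p, r)) (e : 'M[C]_(r, s)) :
  A **m c **m e = A **m (c *m e).
Proof. by apply/funext => k; rewrite /mulr_mseq mulmxA. Qed.

Lemma l2M p r (A : mseq p) (c : 'M[C]_(p, r)) : l2 A -> l2 (A **m c).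
Proof. by move=> A2 v; rewrite mseqMA. Qed.

Lemma l2_col p (A : mseq p) : (forall j, bounded_norm (fun k => col j (A k))) -> l2 A.
Proof.
move=> A2 v.
have -> : A **m v = \sum_j v j 0 *: (fun k => col j (A k)) :> mseq 1.
  apply/funext => k; rewrite fct_sumE; apply/matrixP => i l.
  rewrite ord1 mxE summxE; apply: eq_bigr => j _.
  by rewrite -[(_ *: _) k]/(_ *: col j (A k)) !mxE mulrC.
elim/big_rec: _ => [|j x _ x2]; last by apply/bounded_normD/x2/bounded_normZ.
by exists 0 => m; rewrite ip0l mxE.
Qed.

(** Polarization with a = 1 and a = i reduces the mixed sums to bounded nondecreasing ones. *)
Lemma ip_cvg_vec (x y : mseq 1) : bounded_norm x -> bounded_norm y ->
  cvgn (fun m => ip m x y 0 0).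
Proof.
have N (z : mseq 1) : bounded_norm z -> cvgn (fun m => ip m z z 0 0).
  by move=> [K zK]; apply: nondecreasingC zK => m; exact: ip_le.
move=> x2 y2.
pose P a : nat -> C := fun m => ip m (x + a *: y) (x + a *: y) 0 0.
have cP a : cvgn (P a) by apply/N/bounded_normD/bounded_normZ.
have -> : (fun m => ip m x y 0 0) = fun m => 2^-1 * (P 1 m - ip m x x 0 0 - ip m y y 0 0)
    - 2^-1 * 'i * (P 'i m - ip m x x 0 0 - ip m y y 0 0).
  apply/funext => m; rewrite /P !ipDl !ipDr !ipZl !ipZr !mxE conjCi rmorph1.
  have ii : 'i * 'i = -1 :> C by rewrite -expr2 sqrCi.
  by field: ii.
have cN a : cvgn (fun m => P a m - ip m x x 0 0 - ip m y y 0 0).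
  exact: is_cvgB (is_cvgB (cP a) (N _ x2)) (N _ y2).
apply/cvg_ex; exists (2^-1 * limn (fun m => P 1 m - ip m x x 0 0 - ip m y y 0 0 : C)
  - 2^-1 * 'i * limn (fun m => P 'i m - ip m x x 0 0 - ip m y y 0 0 : C)).
by apply: cvgB; (apply: cvgM; first exact: cvg_cst); exact: cN.
Qed.

(** Meaningful for square summable families only; elsewhere [limn] may return a default value. *)
Definition inn p r (A : mseq p) (B : mseq r) : 'M[C]_(p, r) :=
  \matrix_(i, j) limn (fun m => ip m A B i j : C).

Lemma inn_cvg p r (A : mseq p) (B : mseq r) : l2 A -> l2 B ->
  mxcvg (fun m => ip m A B) (inn A B).
Proof.
move=> A2 B2 i j; rewrite mxE.
have e m : ip m A B i j =
    ip m (A **m delta_mx i (0 : 'I_1)) (B **m delta_mx j (0 : 'I_1)) 0 0.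
  by rewrite ipMl ipMr adjmx_delta -rowE -colE !mxE.
under eq_fun do rewrite e.
exact: ip_cvg_vec.
Qed.

(** [g] is the basis of solutions dual to the columns of [Theta lam] over [0, b). Each coefficient
    is thus a pairing with [g j], and Cauchy-Schwarz bounds it by the norm over [0, b). *)
Lemma l2_fundsol_coef lam : exists K, 0 <= K /\
  forall (c : 'cV[C]_d) j, `|c j 0| ^+ 2 <= K * ip b (Theta lam **m c) (Theta lam **m c) 0 0.
Proof.
pose g (j : 'I_d) := Theta lam **m (invmx (gram lam b) *m delta_mx j (0 : 'I_1)).
exists (\sum_j ip b (g j) (g j) 0 0); split=> [|c j].
  by apply: sumr_ge0 => j _; exact: ip_ge0.
have -> : c j 0 = ip b (g j) (Theta lam **m c) 0 0.
  have Gadj : (gram lam b)^t* = gram lam b by rewrite ip_adj.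
  rewrite ipMl ipMr -/(gram _ _) adjmxM -mulmxA (mulmxA _ (gram _ _)).
  rewrite -{2}Gadj -adjmxM mulmxV ?gram_unit // adjmx1 mul1mx adjmx_delta -rowE.
  by rewrite mxE.
apply: le_trans (ip_cauchy_schwarz _ _ _) _; rewrite ler_wpM2r ?ip_ge0 //.
by rewrite (bigD1 j) //= lerDl sumr_ge0 // => i _; exact: ip_ge0.
Qed.

(** * Projections on the solutions of an eigenvalue equation *)

Section Projection.
Variables (lam : C) (F : mseq 1).
Hypothesis F2 : bounded_norm F.
Hypothesis orth : forall c : 'cV[C]_d, bounded_norm (Theta lam **m c) ->
  inn (Theta lam **m c) F = 0.

(* [proj m] is the orthogonal projection of [F] on the solutions of [S_lam] for
   the inner product truncated to [0, m). *)
Let coef m : 'cV[C]_d := invmx (gram lam m) *m ip m (Theta lam) F.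
Let proj m := Theta lam **m coef m.
Let e m := ip m (proj m) (proj m) 0 0.
Let N m := ip m F F 0 0.

Lemma proj_orth m p (c : 'M[C]_(d, p)) : (b <= m)%N ->
  ip m (Theta lam **m c) (F - proj m) = 0.
Proof.
by move=> bm; rewrite ipMl ipBr ipMr -/(gram _ _) mulKVmx ?gram_unit // subrr mulmx0.
Qed.

Let dist2 m := N m - e m.

Lemma dist2E m : (b <= m)%N -> dist2 m = ip m (F - proj m) (F - proj m) 0 0.
Proof.
move=> bm; have o := proj_orth (coef m) bm; rewrite -/(proj m) in o.
have -> : ip m (F - proj m) (F - proj m) = ip m F (F - proj m).
  by rewrite ipBl o subr0.
move/ip_eq0C/eqP: o; rewrite ipBl subr_eq0 => /eqP o.
by rewrite ipBr o !mxE.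
Qed.

(** Pythagoras over [0, m): F - proj m' is F - proj m minus a solution orthogonal to it, and its
    norm over [0, m) is at most the one over [0, m'). *)
Lemma dist2_le m m' : (b <= m)%N -> (m <= m')%N ->
  ip m (proj m' - proj m) (proj m' - proj m) 0 0 <= dist2 m' - dist2 m.
Proof.
move=> bm mm'; rewrite lerBrDr !dist2E ?(leq_trans bm) //.
apply: le_trans (ip_le _ mm').
have -> : F - proj m' = (F - proj m) - Theta lam **m (coef m' - coef m).
  by rewrite mseqMB opprB addrA subrK.
have o := proj_orth (coef m' - coef m) bm.
have -> : proj m' - proj m = Theta lam **m (coef m' - coef m) by rewrite mseqMB.
move: o; set G := F - proj m; set H := Theta lam **m _ => o.
by rewrite (ipBl m G H) !(ipBr m _ G H) o (ip_eq0C o) subr0 sub0r opprK [leRHS]mxE addrC.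
Qed.

(* The squared distance of [F] to the solutions over [0, m) is nondecreasing in
   [m] and bounded, and controls [coef m' - coef m]; so the coefficients converge
   to those of a square summable solution, to which [F] is orthogonal. *)
Lemma proj_to0 : forall eps : C, 0 < eps ->
  exists2 m0, (b <= m0)%N & forall m, (m0 <= m)%N -> e m <= eps.
Proof.
have [K FK] := F2.
have K0 : 0 <= K by exact: le_trans (ip_ge0 0 F) (FK 0%N).
have d_ge0 m : (b <= m)%N -> 0 <= dist2 m by move=> bm; rewrite dist2E // ip_ge0.
have d_leK m : dist2 m <= K by rewrite (le_trans _ (FK m)) // gerBl ip_ge0.
have d_mono m m' : (b <= m)%N -> (m <= m')%N -> dist2 m <= dist2 m'.
  by move=> bm mm'; rewrite -subr_ge0 (le_trans _ (dist2_le bm mm')) ?ip_ge0.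
have /cvg_ex[dl dcvg] : cvgn (fun m => dist2 (b + m)).
  apply: (@nondecreasingC _ K) => m //.
  by rewrite d_mono ?leq_addr // leq_add2l.
have d_le_dl m : (b <= m)%N -> dist2 m <= dl.
  move=> bm; apply: (cvg_leC (cvg_cst _) dcvg).
  by exists m => // j /= mj; rewrite d_mono // (leq_trans mj) // leq_addl.
have dl_leK : dl <= K by apply: (cvg_leC dcvg (cvg_cst _)); exact: nearW.
have d_small (eps : C) : 0 < eps ->
    exists2 m0, (b <= m0)%N & forall m, (m0 <= m)%N -> dl - dist2 m <= eps.
  move=> eps0; have /cvgrPdist_le/(_ _ eps0)[j0 _ dj] := dcvg.
  exists (b + j0)%N => [|m m0m]; first by rewrite leq_addr.
  have bm : (b <= m)%N by rewrite (leq_trans _ m0m) // leq_addr.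
  have jm : (j0 <= m - b)%N by rewrite leq_subRL.
  have := dj _ jm; rewrite /= subnKC //; apply: le_trans.
  by rewrite real_ler_norm // ger0_real // subr_ge0 d_le_dl.
have [Kc [Kc0 coefK]] := l2_fundsol_coef lam.
have coef_cvg j : cvgn (fun m => coef m j 0).
  apply: cauchyC => eps eps0.
  have k1 : 0 < Kc + 1 by rewrite ltr_wpDl.
  (* [Kc] converts a bound on the squared norm into one on the squared coefficients; the [+ 1]
     guards against Kc = 0. *)
  have [|m0 bm0 dm0] := d_small (eps ^+ 2 / (Kc + 1)).
    by rewrite divr_gt0 // exprn_gt0.
  exists m0 => m m' m0m mm'; have bm : (b <= m)%N by exact: leq_trans m0m.
  rewrite -(ler_pXn2r (ltn0Sn 1)) ?nnegrE ?normr_ge0 ?(ltW eps0) //.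
  have -> : coef m' j 0 - coef m j 0 = (coef m' - coef m) j 0 by rewrite !mxE.
  apply: le_trans (coefK _ j) _.
  have pp : Theta lam **m (coef m' - coef m) = proj m' - proj m.
    by rewrite mseqMB.
  have h : ip b (proj m' - proj m) (proj m' - proj m) 0 0 <= eps ^+ 2 / (Kc + 1).
    apply: le_trans (ip_le _ bm) _; apply: le_trans (dist2_le bm mm') _.
    by apply: le_trans _ (dm0 _ m0m); rewrite lerB // d_le_dl // (leq_trans bm).
  rewrite pp; apply: le_trans (ler_wpM2l Kc0 h) _.
  by rewrite mulrCA ler_piMr ?exprn_ge0 ?(ltW eps0) // ler_pdivrMr // mul1r lerDl.
pose cl : 'cV[C]_d := \col_j limn (fun m => coef m j 0 : C).
have clP : mxcvg coef cl by move=> i j; rewrite ord1 mxE; exact: coef_cvg.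
(* The limit m' -> oo in [dist2_le], with m fixed. *)
have rest m : (b <= m)%N -> ip m (Theta lam **m (cl - coef m))
    (Theta lam **m (cl - coef m)) 0 0 <= dl - dist2 m.
  move=> bm.
  have dc : mxcvg (fun m' => coef m' - coef m) (cl - coef m).
    by apply: mxcvgB clP _; exact: mxcvg_cst.
  have h : mxcvg (fun m' => ip m (proj m' - proj m) (proj m' - proj m))
     (ip m (Theta lam **m (cl - coef m)) (Theta lam **m (cl - coef m))).
    rewrite ipMl ipMr; apply: mxcvg_near; last first.
      apply: mxcvgM (mxcvg_adj dc) _; apply: mxcvgM dc; exact: mxcvg_cst.
    apply: nearW => m' /=; rewrite -ipMr -ipMl.
    by rewrite mseqMB.
  apply: (cvg_leC (h 0 0) (cvg_cst _)); exists m => // m' /= mm'.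
  by apply: le_trans (dist2_le bm mm') _; rewrite lerB // d_le_dl // (leq_trans bm).
have clE m : Theta lam **m cl = Theta lam **m (cl - coef m) + proj m.
  by rewrite mseqMB subrK.
(* The limit solution is a remainder of squared norm at most [dl] plus a projection of squared norm
   at most that of F; both are at most K. *)
have cl2 : bounded_norm (Theta lam **m cl).
  exists (2 * (K + K)) => m; pose m' := maxn b m.
  have bm' : (b <= m')%N by rewrite leq_maxl.
  apply: le_trans (ip_le _ (leq_maxr b m)) _; rewrite -/m' (clE m').
  apply: le_trans (ipD_le _ _ _) _; rewrite ler_pM2l // lerD //.
    apply: le_trans (rest _ bm') _; rewrite (le_trans _ dl_leK) // gerBl.
    exact: d_ge0.
  rewrite (le_trans _ (FK m')) // -subr_ge0; exact: d_ge0.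
have ip0 : (fun m => ip m (Theta lam **m cl) F 0 0) @ \oo --> (0 : C).
  have h : mxcvg _ _ := inn_cvg ((l2_vec _).2 cl2) ((l2_vec _).2 F2).
  have := h 0 0.
  by rewrite orth // mxE.
move=> eps eps0; have e2 : 0 < eps / 2 by rewrite divr_gt0.
have /cvgrPdist_le/(_ _ e2)[m1 _ hm1] := ip0.
have k1 : 0 < K + 1 by rewrite ltr_wpDl.
have [|m2 bm2 dm2] := d_small ((eps / 2) ^+ 2 / (K + 1)).
  by rewrite divr_gt0 // exprn_gt0.
exists (maxn m1 m2) => [|m]; first by rewrite leq_max bm2 orbT.
rewrite geq_max => /andP[m1m m2m]; have bm := leq_trans bm2 m2m.
(* Since [proj m] is a projection, e m = <proj m, F>. Writing [proj m] as the limit solution minus a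
   remainder leaves one term tending to 0 by [orth] and one controlled by Cauchy-Schwarz. *)
have eE : e m = ip m (Theta lam **m cl) F 0 0 - ip m (Theta lam **m (cl - coef m)) F 0 0.
  have := proj_orth (coef m) bm; rewrite ipBr => /eqP; rewrite subr_eq0 => /eqP o.
  by rewrite /e -[ip m (proj m) (proj m)]o (clE m) ipDl mxE addrAC subrr add0r.
rewrite (le_trans (real_ler_norm (ger0_real (ip_ge0 m (proj m))))) //.
rewrite -/(e m) eE (le_trans (ler_normB _ _)) // [leRHS]splitr lerD //.
  by have := hm1 _ m1m; rewrite sub0r normrN.
rewrite -(ler_pXn2r (ltn0Sn 1)) ?nnegrE ?normr_ge0 ?(ltW e2) //.
apply: le_trans (ip_cauchy_schwarz _ _ _) _.
have h := le_trans (rest _ bm) (dm2 _ m2m).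
apply: le_trans (ler_pM (ip_ge0 _ _) (ip_ge0 _ _) h (FK m)) _.
by rewrite mulrAC -mulrA ler_piMr ?exprn_ge0 ?(ltW e2) // ler_pdivrMr // mul1r lerDl.
Qed.

(* The solution [v] of [L v = Psi (lam^* v + F - proj m)] with [v 0 = 0] vanishes
   at [m] too, so [z] may be replaced by [z - v], for which the form is
   [|kappa (z - v) - proj m|^2 - |proj m|^2] with [kappa = lam - lam^*]. *)
Lemma truncated_dissipative (z f : mseq 1) m : sys z f -> F = f - lam^* *: z ->
    (b <= m)%N ->
  - e m <= (lam - lam^*) * (ip m z f - ip m f z) 0 0.
Proof.
move=> sz Ff bm; set a := proj m; pose kappa := lam - lam^*.
pose v := propagate lam^* (F - a) 0.
have sv : sys v (lam^* *: v + (F - a)) := propagate_sys _ _ _.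
have vm : v m = 0.
  (* Against the solutions of S_lam the eigenvalue terms cancel, and F - proj m is orthogonal to
     these solutions; so the bracket at m stays 0. *)
  have := green m (fundsol_sys lam) sv.
  rewrite ipDr ipZl ipZr {2}/jform /= mulmx0 add0r opprD addrA subrr sub0r.
  have -> : ip m (Theta lam) (F - a) = 0.
    by rewrite -[ip m _ _](mul1mx) -adjmx1 -ipMl proj_orth.
  rewrite oppr0; exact: fundsol_adjJ_inj.
pose w := z - v.
have sw : sys w (lam^* *: w + a).
  have := sysB sz sv; congr (sys _ _); rewrite Ff /w scalerBr opprD !opprB addrCA.
  rewrite (addrC f) -addrA subrK [RHS]addrC [LHS]addrC -addrA //.
have jz k : v k = 0 -> jform w w k = jform z z k.
  by rewrite /jform -[w k]/(z k - v k) => ->; rewrite subr0.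
have := green m sw sw; rewrite !jz // (green m sz sz) -!addrA => /addrI.
rewrite {vm sv jz}; clearbody w; rewrite ipDl ipDr ipZl ipZr conjCK => eq1.
rewrite -subr_ge0 opprK; have := ip_ge0 m (kappa *: w - a); congr (0 <= _).
have kadj : kappa^* = - kappa by rewrite rmorphB /= conjCK opprB.
rewrite ipBl !ipBr !ipZl !ipZr kadj -(opprB (ip m f z)) eq1 /e -/a !mxE /kappa; ring.
Qed.

Lemma limit_dissipative (z f : mseq 1) : sys z f -> bounded_norm z -> bounded_norm f ->
  F = f - lam^* *: z -> 0 <= (lam - lam^*) * (inn z f - inn f z) 0 0.
Proof.
move=> sz z2 f2 Ff.
have h : mxcvg (fun m => ip m z f - ip m f z) (inn z f - inn f z).
  by apply: mxcvgB; apply: inn_cvg; apply/l2_vec.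
have e0 : e @ \oo --> (0 : C).
  apply/cvgrPdist_le => eps eps0; have [m0 bm0 em0] := proj_to0 eps0.
  exists m0 => // m /= m0m; rewrite sub0r normrN.
  by rewrite ger0_norm ?em0 // ip_ge0.
have lamcst : (fun=> lam - lam^* : C) @ \oo --> lam - lam^* by exact: cvg_cst.
have := cvg_ge0C (cvgD (cvgM lamcst (h 0 0)) e0); rewrite addr0; apply.
exists b => // m /= bm; rewrite -lerBlDr sub0r; exact: truncated_dissipative.
Qed.

End Projection.

Lemma innDl p r (A A' : mseq p) (B : mseq r) : l2 A -> l2 A' -> l2 B ->
  inn (A + A') B = inn A B + inn A' B.
Proof.
move=> A2 A'2 B2; apply: mxcvg_unique (inn_cvg (l2D A2 A'2) B2) _.
by under eq_fun do rewrite ipDl; apply: mxcvgD; exact: inn_cvg.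
Qed.

Lemma innMl p p' r (A : mseq p) (c : 'M[C]_(p, p')) (B : mseq r) : l2 A -> l2 B ->
  inn (A **m c) B = c ^t* *m inn A B.
Proof.
move=> A2 B2; apply: mxcvg_unique (inn_cvg (l2M c A2) B2) _.
under eq_fun do rewrite ipMl.
by apply: mxcvgM; [exact: mxcvg_cst | exact: inn_cvg].
Qed.

Lemma inn_adj p r (A : mseq p) (B : mseq r) : l2 A -> l2 B -> (inn A B) ^t* = inn B A.
Proof.
move=> A2 B2; apply: mxcvg_unique (inn_cvg B2 A2).
by under eq_fun do rewrite -ip_adj; apply: mxcvg_adj; exact: inn_cvg.
Qed.

Lemma innDr p r (A : mseq p) (B B' : mseq r) : l2 A -> l2 B -> l2 B' ->
  inn A (B + B') = inn A B + inn A B'.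
Proof.
by move=> A2 B2 B'2; rewrite -inn_adj ?innDl ?adjmxD ?inn_adj //; exact: l2D.
Qed.

Lemma innMr p r r' (A : mseq p) (B : mseq r) (c : 'M[C]_(r, r')) : l2 A -> l2 B ->
  inn A (B **m c) = inn A B *m c.
Proof.
by move=> A2 B2; rewrite -inn_adj ?innMl ?adjmxM ?trmxCK ?inn_adj //; exact: l2M.
Qed.

Lemma mseqM_scalar p (A : mseq p) a : A **m a%:M = a *: A.
Proof. by apply/funext => k; rewrite /mulr_mseq mul_mx_scalar. Qed.

Lemma innZl p r a (A : mseq p) (B : mseq r) : l2 A -> l2 B ->
  inn (a *: A) B = a^* *: inn A B.
Proof.
move=> A2 B2; rewrite -mseqM_scalar innMl // tr_scalar_mx map_scalar_mx.
exact: mul_scalar_mx.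
Qed.

Lemma innZr p r a (A : mseq p) (B : mseq r) : l2 A -> l2 B ->
  inn A (a *: B) = a *: inn A B.
Proof. by move=> A2 B2; rewrite -mseqM_scalar innMr // mul_mx_scalar. Qed.

Lemma innBr p r (A : mseq p) (B B' : mseq r) : l2 A -> l2 B -> l2 B' ->
  inn A (B - B') = inn A B - inn A B'.
Proof.
move=> A2 B2 B'2; rewrite -(scaleN1r B') innDr //; last exact: l2Z.
by rewrite innZr // scaleN1r.
Qed.

(** * The form omega on the maximal relation and the brackets at the endpoint *)

Local Notation mpair p := ((mseq p) * (mseq p))%type.

(* [(A, F)] with [L A = Psi F], columnwise: a representative of an element of
   the maximal relation. *)
Definition dom p (P : mpair p) : Prop := [/\ sys P.1 P.2, l2 P.1 & l2 P.2].

Definition omega p r (P : mpair p) (Q : mpair r) : 'M[C]_(p, r) :=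
  inn P.2 Q.1 - inn P.1 Q.2.

Definition mulr_pair p r (P : mpair p) (c : 'M[C]_(p, r)) : mpair r :=
  (P.1 **m c, P.2 **m c).
Local Notation "P **p c" := (mulr_pair P c) (at level 40, left associativity).

Lemma domD p (P Q : mpair p) : dom P -> dom Q -> dom (P + Q).
Proof.
by move=> [sP P1 P2] [sQ Q1 Q2]; split; [exact: sysD | exact: l2D | exact: l2D].
Qed.

Lemma domZ p a (P : mpair p) : dom P -> dom (a *: P).
Proof. by move=> [sP P1 P2]; split; [exact: sysZ | exact: l2Z | exact: l2Z]. Qed.

Lemma domB p (P Q : mpair p) : dom P -> dom Q -> dom (P - Q).
Proof. 
by move=> [sP P1 P2] [sQ Q1 Q2]; split; [exact: sysB | exact: l2B | exact: l2B].
Qed.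

Lemma domM p r (P : mpair p) (c : 'M[C]_(p, r)) : dom P -> dom (P **p c).
Proof. by move=> [sP P1 P2]; split; [exact: sysM | exact: l2M | exact: l2M]. Qed.

Lemma omega_adj p r (P : mpair p) (Q : mpair r) : dom P -> dom Q ->
  (omega P Q) ^t* = - omega Q P.
Proof.
by move=> [_ P1 P2] [_ Q1 Q2]; rewrite adjmxB !inn_adj // opprB.
Qed.

Lemma omegaDr p r (P : mpair p) (Q Q' : mpair r) : dom P -> dom Q -> dom Q' ->
  omega P (Q + Q') = omega P Q + omega P Q'.
Proof.
move=> [_ P1 P2] [_ Q1 Q2] [_ Q1' Q2']; rewrite /omega.
by rewrite innDr // (@innDr _ _ P.1 Q.2) // opprD addrACA.
Qed.

Lemma omegaZr p r a (P : mpair p) (Q : mpair r) : dom P -> dom Q ->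
  omega P (a *: Q) = a *: omega P Q.
Proof.
move=> [_ P1 P2] [_ Q1 Q2]; rewrite /omega innZr // (@innZr _ _ a P.1 Q.2) //.
by rewrite scalerBr.
Qed.

Lemma omegaBr p r (P : mpair p) (Q Q' : mpair r) : dom P -> dom Q -> dom Q' ->
  omega P (Q - Q') = omega P Q - omega P Q'.
Proof.
move=> [_ P1 P2] [_ Q1 Q2] [_ Q1' Q2']; rewrite /omega.
by rewrite innBr // (@innBr _ _ P.1 Q.2) // opprD addrACA -opprD.
Qed.

Lemma omegaMr p r s (P : mpair p) (Q : mpair r) (c : 'M[C]_(r, s)) : dom P -> dom Q ->
  omega P (Q **p c) = omega P Q *m c.
Proof. by move=> [_ P1 P2] [_ Q1 Q2]; rewrite /omega !innMr // mulmxBl. Qed.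

Lemma omegaMl p r s (P : mpair p) (Q : mpair r) (c : 'M[C]_(p, s)) : dom P -> dom Q ->
  omega (P **p c) Q = c ^t* *m omega P Q.
Proof. by move=> [_ P1 P2] [_ Q1 Q2]; rewrite /omega !innMl // mulmxBr. Qed.

Lemma omegaC0 p r (P : mpair p) (Q : mpair r) : dom P -> dom Q ->
  omega P Q = 0 -> omega Q P = 0.
Proof.
move=> dP dQ PQ; apply/eqP; rewrite -oppr_eq0 -omega_adj // PQ.
by rewrite adjmx0.
Qed.

Lemma omegaDl p r (P P' : mpair p) (Q : mpair r) : dom P -> dom P' -> dom Q ->
  omega (P + P') Q = omega P Q + omega P' Q.
Proof.
move=> dP dP' dQ; rewrite -[omega (P + P') Q]trmxCK omega_adj //; last exact: domD.
rewrite (omegaDr dQ dP dP') adjmxN adjmxD (omega_adj dQ dP) (omega_adj dQ dP').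
by rewrite -opprD; exact: opprK.
Qed.

Lemma omegaZl p r a (P : mpair p) (Q : mpair r) : dom P -> dom Q ->
  omega (a *: P) Q = a^* *: omega P Q.
Proof.
move=> dP dQ; rewrite -[omega (a *: P) Q]trmxCK omega_adj //; last exact: domZ.
by rewrite omegaZr // adjmxN adjmxZ omega_adj // scalerN opprK.
Qed.

Definition jend p r (A : mseq p) (B : mseq r) : 'M[C]_(p, r) :=
  \matrix_(i, j) limn (fun m => jform A B m i j : C).

Lemma mxcvg_jend p r (A : mseq p) (B : mseq r) l :
  mxcvg (jform A B) l -> jend A B = l.
Proof. by move=> h; apply/matrixP => i j; rewrite mxE; apply: cvg_lim (h i j). Qed.

Lemma jform_cvg p r (P : mpair p) (Q : mpair r) : dom P -> dom Q ->
  mxcvg (jform P.1 Q.1) (jform P.1 Q.1 0 + omega P Q).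
Proof.
move=> [sP P1 P2] [sQ Q1 Q2].
apply: mxcvg_near; first by apply: nearW => m; rewrite (green m sP sQ) -addrA.
apply: mxcvgD; first exact: mxcvg_cst.
by apply: mxcvgB; apply: inn_cvg.
Qed.

Lemma jendE p r (P : mpair p) (Q : mpair r) : dom P -> dom Q ->
  jend P.1 Q.1 = jform P.1 Q.1 0 + omega P Q.
Proof. by move=> dP dQ; exact: mxcvg_jend (jform_cvg dP dQ). Qed.

Lemma jend0l p r (A : mseq p) (B : mseq r) :
  (exists m, forall k, (m <= k)%N -> A k = 0) -> jend A B = 0.
Proof.
move=> [m A0]; apply: mxcvg_jend; apply: mxcvg_near (@mxcvg_cst _ _ _ 0).
by exists m => // k /= mk; rewrite /jform A0 // adjmx0 !mul0mx.
Qed.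

Lemma jend0r p r (A : mseq p) (B : mseq r) :
  (exists m, forall k, (m <= k)%N -> B k = 0) -> jend A B = 0.
Proof.
move=> [m B0]; apply: mxcvg_jend; apply: mxcvg_near (@mxcvg_cst _ _ _ 0).
by exists m => // k /= mk; rewrite /jform B0 // mulmx0.
Qed.

Lemma finite_l2 p (A : mseq p) m : (forall k, (m <= k)%N -> A k = 0) -> l2 A.
Proof.
move=> A0 v; exists (ip m (A **m v) (A **m v) 0 0) => k.
apply: le_trans (ip_le _ (leq_maxr m k)) _.
rewrite (ip_stable _ (leq_maxl m k)) // => j mj.
by rewrite /mulr_mseq A0 // mul0mx mulmx0.
Qed.

(** * Decomposition of the maximal relation *)

Section Deficiency.
Variables (lam : C) (q : nat) (E1 E2 : mseq q).
Hypothesis lam_nreal : lam - lam^* != 0.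
Hypothesis E1sys : sys E1 (lam *: E1).
Hypothesis E2sys : sys E2 (lam^* *: E2).
Hypothesis E12 : l2 E1.
Hypothesis E22 : l2 E2.
Hypothesis E1free : forall x : 'cV[C]_q, E1 0%N *m x = 0 -> x = 0.
Hypothesis E2free : forall x : 'cV[C]_q, E2 0%N *m x = 0 -> x = 0.
Hypothesis E1span : forall c : 'cV[C]_d, bounded_norm (Theta lam **m c) ->
  exists x, Theta lam **m c = E1 **m x.
Hypothesis E2span : forall c : 'cV[C]_d, bounded_norm (Theta lam^* **m c) ->
  exists x, Theta lam^* **m c = E2 **m x.

Definition defpair : mpair (q + q) :=
  (fun k => row_mx (E1 k) (E2 k), fun k => row_mx (lam *: E1 k) (lam^* *: E2 k)).

Let pair1 : mpair q := (E1, lam *: E1).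
Let pair2 : mpair q := (E2, lam^* *: E2).

Lemma defpairM p (x : 'M[C]_(q + q, p)) :
  defpair **p x = pair1 **p usubmx x + pair2 **p dsubmx x.
Proof.
rewrite -{1}(vsubmxK x); congr pair; apply/funext => k; rewrite /mulr_pair /mulr_mseq /=;
  exact: mul_row_col.
Qed.

Lemma dom_pair1 : dom pair1. Proof. by split => //; exact: l2Z. Qed.
Lemma dom_pair2 : dom pair2. Proof. by split => //; exact: l2Z. Qed.

Lemma dom_defpair : dom defpair.
Proof.
have : dom (defpair **p 1%:M).
  by rewrite defpairM; apply: domD; apply: domM; [exact: dom_pair1 | exact: dom_pair2].
have -> : defpair **p 1%:M = defpair.
  by congr pair; apply/funext => k; rewrite /mulr_mseq mulmx1.
by [].
Qed.

Lemma pair1E : pair1 = defpair **p col_mx 1%:M 0.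
Proof.
by congr pair; apply/funext => k; rewrite /mulr_mseq /= mul_row_col mulmx1 mulmx0 addr0.
Qed.

Lemma pair2E : pair2 = defpair **p col_mx 0 1%:M.
Proof.
by congr pair; apply/funext => k; rewrite /mulr_mseq /= mul_row_col mulmx1 mulmx0 add0r.
Qed.

Lemma omega11 : omega pair1 pair1 = (lam^* - lam) *: inn E1 E1.
Proof. by rewrite /omega innZl // (@innZr _ _ lam) // scalerBl. Qed.

Lemma omega22 : omega pair2 pair2 = (lam - lam^*) *: inn E2 E2.
Proof. by rewrite /omega innZl // (@innZr _ _ lam^*) // conjCK scalerBl. Qed.

Lemma omega12 : omega pair1 pair2 = 0.
Proof. by rewrite /omega innZl // (@innZr _ _ lam^*) // subrr. Qed.

Lemma omega21 : omega pair2 pair1 = 0.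
Proof. exact: omegaC0 dom_pair1 dom_pair2 omega12. Qed.

(** The solution [E **m x] has norm zero, whereas definiteness gives a solution with nonzero initial
    value positive norm over [0, b). *)
Lemma inn_eigen_inj mu (E : mseq q) (x : 'cV[C]_q) : sys E (mu *: E) -> l2 E ->
  inn E E *m x = 0 -> E 0%N *m x = 0.
Proof.
move=> sE E2' Ex; apply/eqP/negPn/negP => x0.
have sx : sys (E **m x) (mu *: (E **m x)).
  by have := sysM x sE; congr (sys _ _); apply/funext => k; rewrite /mulr_mseq -scalemxAl.
have Ex2 := l2M x E2'; have h : mxcvg _ _ := inn_cvg Ex2 Ex2.
suff : ip b (E **m x) (E **m x) 0 0 <= 0 by rewrite lt_geF // (definite sx x0).
apply: (cvg_leC (cvg_cst _) (_ : _ @ \oo --> (0 : C))); last first.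
  by exists b => // m /= bm; exact: ip_le bm.
by have := h 0 0; rewrite innMl // innMr // Ex mulmx0 mxE.
Qed.

(** Block diagonal in the splitting by [pair1] and [pair2]: the mixed block cancels, and the
    diagonal blocks are Gram matrices of independent solutions times lam^* - lam and its
    opposite. *)
Lemma gram_omega_unit : omega defpair defpair \in unitmx.
Proof.
apply: unitmx_inj => v Gv; have dd := dom_defpair.
have d1 := dom_pair1; have d2 := dom_pair2.
have Gv0 : omega defpair (defpair **p v) = 0 by rewrite omegaMr.
have dv := domM v dd.
have o1 : omega pair1 (defpair **p v) = 0 by rewrite pair1E omegaMl // Gv0 mulmx0.
have o2 : omega pair2 (defpair **p v) = 0 by rewrite pair2E omegaMl // Gv0 mulmx0.
rewrite -[v]vsubmxK; move: o1 o2.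
rewrite defpairM !omegaDr //; try by apply: domM.
rewrite !omegaMr // omega12 omega21 !mul0mx addr0 add0r omega11 omega22 -!scalemxAl.
move=> /eqP; rewrite scaler_eq0 -opprB oppr_eq0 (negPf lam_nreal) => /eqP x1.
move=> /eqP; rewrite scaler_eq0 (negPf lam_nreal) => /eqP x2.
rewrite (E1free (inn_eigen_inj E1sys E12 x1)) (E2free (inn_eigen_inj E2sys E22 x2)).
by rewrite col_mx0.
Qed.

Lemma omega_orth_null (P : mpair 1) : dom P -> omega defpair P = 0 -> omega P P = 0.
Proof.
move=> dP oP; case: (dP) => [sP P12 P22].
have o1 : omega pair1 P = 0 by rewrite pair1E omegaMl ?oP ?mulmx0 //; exact: dom_defpair.
have o2 : omega pair2 P = 0 by rewrite pair2E omegaMl ?oP ?mulmx0 //; exact: dom_defpair.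
have F2 mu : bounded_norm (P.2 - mu *: P.1) by apply/l2_vec/l2B => //; exact: l2Z.
have i1 : inn E1 (P.2 - lam^* *: P.1) = 0.
  rewrite innBr //; last exact: l2Z.
  by rewrite innZr //; apply/eqP; rewrite -oppr_eq0 opprB -o1 /omega /= innZl.
have i2 : inn E2 (P.2 - lam *: P.1) = 0.
  rewrite innBr //; last exact: l2Z.
  by rewrite innZr //; apply/eqP; rewrite -oppr_eq0 opprB -o2 /omega /= innZl // conjCK.
have /l2_vec b1 := P12; have /l2_vec b2 := P22.
have h1 : 0 <= (lam - lam^*) * (inn P.1 P.2 - inn P.2 P.1) 0 0.
  apply: (@limit_dissipative lam _ (F2 lam^*)) => // c /E1span[x ->].
  by rewrite innMl ?i1 ?mulmx0 //; apply/l2_vec.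
have h2 : 0 <= (lam^* - lam) * (inn P.1 P.2 - inn P.2 P.1) 0 0.
  rewrite -[X in _ - X]conjCK.
  apply: (@limit_dissipative lam^* _ (F2 lam)) => //; last by rewrite conjCK.
  by move=> c /E2span[x ->]; rewrite innMl ?i2 ?mulmx0 //; apply/l2_vec.
have h0 : (lam - lam^*) * (inn P.1 P.2 - inn P.2 P.1) 0 0 = 0.
  by apply/eqP; rewrite eq_le h1 andbT -oppr_ge0 -mulNr opprB.
apply/matrixP => i j; rewrite !ord1 /omega -opprB [LHS]mxE [RHS]mxE.
by move/eqP: h0; rewrite mulf_eq0 (negPf lam_nreal) => /eqP ->; rewrite oppr0.
Qed.

(** The pairs orthogonal to the eigensolutions form a subspace on which omega(P, P) vanishes;
    polarization with a = 1 and a = i extends this to omega(P, Q). *)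
Lemma omega_orth_polar (P Q : mpair 1) : dom P -> dom Q ->
  omega defpair P = 0 -> omega defpair Q = 0 -> omega P Q = 0.
Proof.
move=> dP dQ oP oQ; have dd := dom_defpair.
have polar a : a^* *: omega Q P + a *: omega P Q = 0.
  have daQ := domZ a dQ; have dPQ := domD dP daQ.
  have := omega_orth_null dPQ; rewrite omegaDr // omegaZr // oP oQ scaler0 addr0.
  move=> /(_ erefl); rewrite omegaDl // !omegaDr // !omegaZl // !omegaZr //.
  by rewrite !omega_orth_null // !scaler0 addr0 add0r addrC.
have h1 := polar 1; have h2 := polar 'i.
move: h1; rewrite conjC1 !scale1r => /eqP; rewrite addr_eq0 => /eqP QP.
move: h2; rewrite conjCi QP scaleNr scalerN opprK -mulr2n => /eqP.
rewrite -scaler_nat scaler_eq0 pnatr_eq0 /= scaler_eq0 (negPf (neq0Ci C)) => /eqP //.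
Qed.

(** Coefficients of the omega-orthogonal projection on the eigensolutions. *)
Definition dcoef p (P : mpair p) : 'M[C]_(q + q, p) :=
  invmx (omega defpair defpair) *m omega defpair P.

Lemma omega_defpair_rest p (P : mpair p) : dom P ->
  omega defpair (P - defpair **p dcoef P) = 0.
Proof.
move=> dP; have dd := dom_defpair.
rewrite omegaBr ?omegaMr ?mulKVmx ?subrr ?gram_omega_unit //.
exact: domM.
Qed.

Lemma dom_rest p (P : mpair p) : dom P -> dom (P - defpair **p dcoef P).
Proof. by move=> dP; apply/domB/domM => //; exact: dom_defpair. Qed.

Lemma omega_entry p r (P : mpair p) (Q : mpair r) i j : dom P -> dom Q ->
  omega P Q i j =
  omega (P **p delta_mx i (0 : 'I_1)) (Q **p delta_mx j (0 : 'I_1)) 0 0.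
Proof.
move=> dP dQ; have dQj := domM (delta_mx j (0 : 'I_1)) dQ.
by rewrite omegaMl // omegaMr // adjmx_delta -rowE -colE !mxE.
Qed.

(** The remainder of P is orthogonal to the remainder of Q by [omega_orth_polar], applied to
    columns, and to the eigensolutions by construction; so it lies in the radical. *)
Lemma deficiency_decomposition p r (P : mpair p) (Q : mpair r) : dom P -> dom Q ->
  omega (P - defpair **p dcoef P) Q = 0.
Proof.
move=> dP dQ; have dd := dom_defpair; have dR := dom_rest dP; have dR' := dom_rest dQ.
have orth : omega (P - defpair **p dcoef P) (Q - defpair **p dcoef Q) = 0.
  apply/matrixP => i j; rewrite omega_entry // omega_orth_polar ?mxE //.
  - exact: domM.
  - exact: domM.
  - by rewrite omegaMr // omega_defpair_rest ?mul0mx.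
  - by rewrite omegaMr // omega_defpair_rest ?mul0mx.
have dQc := domM (dcoef Q) dd.
rewrite -[Q](subrK (defpair **p dcoef Q)) (omegaDr dR dR' dQc) orth add0r.
by rewrite (omegaMr _ dR dd) (omegaC0 dd dR (omega_defpair_rest dP)) mul0mx.
Qed.

Lemma omega_dcoefr p r (P : mpair p) (Q : mpair r) : dom P -> dom Q ->
  omega P Q = omega P defpair *m dcoef Q.
Proof.
move=> dP dQ; have dd := dom_defpair; have dR := dom_rest dQ.
have := omegaC0 dR dP (deficiency_decomposition dQ dP).
rewrite omegaBr //; last exact: domM.
by rewrite omegaMr // => /eqP; rewrite subr_eq0 => /eqP.
Qed.

Lemma omega_dcoef p r (P : mpair p) (Q : mpair r) : dom P -> dom Q ->
  omega P Q = (dcoef P) ^t* *m omega defpair defpair *m dcoef Q.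
Proof.
move=> dP dQ; have dd := dom_defpair; rewrite omega_dcoefr //.
by rewrite -[omega P _]trmxCK omega_adj // omega_dcoefr // adjmxN adjmxM omega_adj //
  mulmxN opprK.
Qed.

Lemma dcoef_defpair p (c : 'M[C]_(q + q, p)) : dcoef (defpair **p c) = c.
Proof.
by rewrite /dcoef omegaMr ?mulKmx ?gram_omega_unit //; exact: dom_defpair.
Qed.

Lemma jend_dcoef p r (P : mpair p) (Q : mpair r) : dom P -> dom Q ->
  Q.1 0%N = defpair.1 0%N *m dcoef Q ->
  jend P.1 Q.1 = jend P.1 defpair.1 *m dcoef Q.
Proof.
move=> dP dQ Q0; rewrite !jendE //; last exact: dom_defpair.
by rewrite mulmxDl -omega_dcoefr // /jform Q0 !mulmxA.
Qed.

Lemma starting_pair : exists P : mpair d,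
  [/\ dom P, P.1 0%N = 1%:M & forall k, (b <= k)%N -> P.1 k = 0 /\ P.2 k = 0].
Proof.
have [A [F [sA A0 AF0]]] := start_free 1%:M.
by exists (A, F); split => //; split => //; apply: finite_l2 => k bk; case: (AF0 k bk).
Qed.

(** Testing the remainder against pairs of finite support that start at the identity removes both
    omega and the endpoint bracket from Lagrange's identity; what is left says that the remainder
    starts at 0. *)
Lemma initial_dcoef p (P : mpair p) : dom P -> P.1 0%N = defpair.1 0%N *m dcoef P.
Proof.
move=> dP; have [S0 [dS S01 S0b]] := starting_pair; have dR := dom_rest dP.
have := jendE dS dR; rewrite jend0l; last by exists b => k /S0b[].
rewrite (omegaC0 dR dS (deficiency_decomposition dP dS)) addr0.
rewrite /jform S01 adjmx1 mul1mx => /esym J0.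
have : P.1 0%N - defpair.1 0%N *m dcoef P = 0 by rewrite -[LHS](mulKmx J_unit) J0 mulmx0.
by move/eqP; rewrite subr_eq0 => /eqP.
Qed.

(** Supplies the matrix [C0] of the algebraic part: modulo the radical, these combinations of
    eigensolutions are the pairs of finite support. *)
Lemma jend_null_initial : exists c0 : 'M[C]_(q + q, d),
  defpair.1 0%N *m c0 = 1%:M /\ jend defpair.1 defpair.1 *m c0 = 0.
Proof.
have [S0 [dS S01 S0b]] := starting_pair; exists (dcoef S0).
split; first by rewrite -(initial_dcoef dS).
rewrite -(jend_dcoef dom_defpair dS (initial_dcoef dS)).
by apply: jend0r; exists b => k /S0b[].
Qed.

(** * Boundary values *)

Section BoundaryTriple.
Variables (r : nat) (U : 'M[C]_(r, q + q)) (Omega : 'M[C]_r).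
Hypothesis rE : r = (q + q - d)%N.
Hypothesis rankU : \rank (U *m jend defpair.1 defpair.1) = r.
Hypothesis OmegaE : Omega = U *m jend defpair.1 defpair.1 *m U ^t*.

(** The adjoint of [U] appears because the bracket is conjugate-linear in its first argument. *)
Definition boundary_value (P : mpair 1) : 'cV[C]_(d + r) :=
  col_mx (P.1 0%N) (jend (defpair.1 **m U ^t*) P.1).

Definition boundary_mx : 'M[C]_(d + r) := block_mx (- J) 0 0 (- invmx Omega).

Lemma jend_defpair_adj : (jend defpair.1 defpair.1) ^t* = - jend defpair.1 defpair.1.
Proof.
have dd := dom_defpair; rewrite jendE // adjmxD omega_adj // [RHS]opprD; congr (_ - _).
by rewrite /jform !adjmxM trmxCK Jadj mulNmx mulmxN mulmxA.
Qed.

Lemma omega_defpairE : omega defpair defpair =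
  jend defpair.1 defpair.1 - (defpair.1 0%N) ^t* *m J *m defpair.1 0%N.
Proof.
have dd := dom_defpair; rewrite jendE // -/(jform defpair.1 defpair.1 0).
by rewrite addrAC subrr add0r.
Qed.

Lemma jend_head (P : mpair 1) : dom P ->
  jend (defpair.1 **m U ^t*) P.1 = U *m jend defpair.1 defpair.1 *m dcoef P.
Proof.
move=> dP; have dd := dom_defpair.
rewrite -mulmxA -(jend_dcoef dd dP (initial_dcoef dP)).
rewrite (jendE (P := defpair **p U ^t*)) ?(jendE dd dP) //; last exact: domM.
rewrite omegaMl // trmxCK [RHS]mulmxDr; congr (_ + _).
by rewrite /jform /mulr_pair /mulr_mseq /= adjmxM trmxCK !mulmxA.
Qed.

Lemma boundary_valueE (P : mpair 1) : dom P ->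
  boundary_value P = col_mx (defpair.1 0%N) (U *m jend defpair.1 defpair.1) *m dcoef P.
Proof.
by move=> dP; rewrite /boundary_value jend_head // mul_col_mx -initial_dcoef.
Qed.

Lemma defpair_gram_unit :
  jend defpair.1 defpair.1 - (defpair.1 0%N) ^t* *m J *m defpair.1 0%N \in unitmx.
Proof. by rewrite -omega_defpairE gram_omega_unit. Qed.

Lemma boundary_triple :
  [/\ (d + r)%N = (q + q)%N,
      Omega \in unitmx /\ Omega ^t* = - Omega,
      forall a (P Q : mpair 1), dom P -> dom Q ->
        boundary_value (a *: P + Q) = a *: boundary_value P + boundary_value Q,
      forall w, exists2 P : mpair 1, dom P & boundary_value P = w &
      forall P Q : mpair 1, dom P -> dom Q ->
        omega P Q = (boundary_value P) ^t* *m boundary_mx *m boundary_value Q].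
Proof.
have [c0 [c01 c00]] := jend_null_initial; have dd := dom_defpair.
have adj := jend_defpair_adj; have unit := defpair_gram_unit.
split.
- exact: boundary_dim c01 rE.
- split; first exact (Omega_unit adj c01 c00 rE rankU OmegaE).
  exact (Omega_adj adj OmegaE).
- move=> a P Q dP dQ; have daP := domZ a dP.
  rewrite !boundary_valueE //; last exact: domD.
  have -> : dcoef (a *: P + Q) = a *: dcoef P + dcoef Q.
    by rewrite /dcoef omegaDr // omegaZr // mulmxDr -scalemxAr.
  by rewrite mulmxDr -scalemxAr.
- move=> w; have [c cw] := boundary_onto unit c01 c00 rE rankU w.
  exists (defpair **p c); first exact: domM.
  by rewrite boundary_valueE ?dcoef_defpair //; exact: domM.
move=> P Q dP dQ; rewrite omega_dcoef // omega_defpairE.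
rewrite (boundary_formE J adj c01 c00 rE rankU OmegaE).
rewrite -!initial_dcoef // -!jend_head // /boundary_value /boundary_mx.
rewrite tr_col_mx map_row_mx mul_row_block mul_row_col !mulmx0 add0r addr0.
by rewrite !(mulmxN, mulNmx) addrC.
Qed.

End BoundaryTriple.

End Deficiency.

End System.

(** * The system of the statement *)

(** Cauchy-Schwarz for the semidefinite form, applied to v and u = P v, since |P v|^2 = u^* P v. *)
Lemma psd_null (C : numClosedFieldType) m (P : 'M[C]_m) (v : 'cV[C]_m) :
    P ^t* = P -> (forall w : 'cV[C]_m, 0 <= (w ^t* *m P *m w) 0 0) ->
  (v ^t* *m P *m v) 0 0 = 0 -> P *m v = 0.
Proof.
move=> Padj Pge0 v0; apply: adjmx_mul_eq0; apply/matrixP => i j; rewrite !ord1.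
set u := P *m v; have -> : u ^t* *m u = u ^t* *m P *m v by rewrite -mulmxA.
rewrite [RHS]mxE; apply/eqP; rewrite -normr_le0.
suff : `|(u ^t* *m P *m v) 0 0| ^+ 2 <= (u ^t* *m P *m u) 0 0 * (v ^t* *m P *m v) 0 0.
  rewrite v0 mulr0 => h; have : `|(u ^t* *m P *m v) 0 0| ^+ 2 == 0.
    by rewrite eq_le h exprn_ge0.
  by rewrite expf_eq0 /= => /eqP ->; exact: lexx.
clearbody u; apply: discriminant_le => // t; have := Pge0 (u - t *: v).
rewrite adjmxB adjmxZ !(mulmxBl, mulmxBr) -!(scalemxAl, scalemxAr).
have -> : v ^t* *m P *m u = (u ^t* *m P *m v) ^t*.
  by rewrite !adjmxM Padj trmxCK mulmxA.
move: (u ^t* *m P *m u) (u ^t* *m P *m v) (v ^t* *m P *m v) => a c b.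
by rewrite !mxE; congr (0 <= _); ring.
Qed.

(** Used with K = J Psi_k, whose square vanishes by isotropy: then 1 - lam K has inverse 1 + lam K,
    which passes between (S_lam) and L z = lam Psi z. *)
Lemma nilpotent_resolvent (C : fieldType) m (a : C) (x s : 'cV[C]_m) (K : 'M[C]_m) :
  K *m K = 0 -> (x = s - a *: (K *m s) <-> s = x + a *: (K *m x)).
Proof.
move=> KK; split=> ->; rewrite !(mulmxDr, mulmxN) -!scalemxAr !mulmxA KK mul0mx scaler0.
  by rewrite subr0 subrK.
by rewrite addr0 addrK.
Qed.

Lemma normC_le_mul (R : realType) (c : CC R) (a b : R) : 0 <= a -> 0 <= b ->
  `|c| ^+ 2 <= (a ^+ 2)%:C%C * (b ^+ 2)%:C%C -> `|c| <= (a * b)%:C%C.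
Proof.
move=> a0 b0 h; rewrite -(ler_pXn2r (ltn0Sn 1)) ?nnegrE ?normr_ge0 //.
  by rewrite (le_trans h) // -rmorphM -rmorphXn exprMn.
by rewrite ler0c mulr_ge0.
Qed.

Lemma eq_colP (V : pzSemiRingType) p r (A B : 'M[V]_(p, r)) :
  (forall j, A *m delta_mx j (0 : 'I_1) = B *m delta_mx j (0 : 'I_1)) -> A = B.
Proof.
move=> AB; apply/matrixP => i j; have := AB j; rewrite -!colE => /matrixP/(_ i 0).
by rewrite !mxE.
Qed.

Lemma mxB_entry (V : zmodType) p r (A B : 'M[V]_(p, r)) i j :
  (A - B) i j = A i j - B i j.
Proof. by rewrite !mxE. Qed.

Lemma eq_ip_Psi (C : numClosedFieldType) d (Psi : nat -> 'M[C]_d) p r m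
    (A A' : nat -> 'M[C]_(d, p)) (B B' : nat -> 'M[C]_(d, r)) :
    (forall k, (Psi k) ^t* = Psi k) ->
    (forall k, Psi k *m A k = Psi k *m A' k) ->
    (forall k, Psi k *m B k = Psi k *m B' k) ->
  ip Psi m A B = ip Psi m A' B'.
Proof.
move=> Padj eA eB; apply: eq_bigr => k _.
have eA' : (A k) ^t* *m Psi k = (A' k) ^t* *m Psi k.
  by rewrite -Padj -!adjmxM eA.
by rewrite eA' -!mulmxA eB.
Qed.

Lemma eq_inn_Psi (C : numClosedFieldType) d (Psi : nat -> 'M[C]_d) p r
    (A A' : nat -> 'M[C]_(d, p)) (B B' : nat -> 'M[C]_(d, r)) :
    (forall k, (Psi k) ^t* = Psi k) ->
    (forall k, Psi k *m A k = Psi k *m A' k) ->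
    (forall k, Psi k *m B k = Psi k *m B' k) ->
  inn Psi A B = inn Psi A' B'.
Proof.
move=> Padj eA eB; apply/matrixP => i j; rewrite !mxE.
by under eq_fun do rewrite (eq_ip_Psi _ Padj eA eB).
Qed.

Section Extension.
Variables (R : realType) (n : nat) (N : option nat) (Y : dsystem R n N).
Local Notation C := (CC R).
Local Notation J := (Jmx R n).
Local Notation seqs := (dseq R n N).
Local Notation mseq p := (nat -> 'M[C]_(n + n, p)).

Lemma Jmx_mul : J *m J = - 1%:M.
Proof.
rewrite /Jmx mulmx_block !(mulmx0, mul0mx, mulmx1, mul1mx) !(add0r, addr0).
by rewrite (scalar_mx_block n n 1) opp_block_mx !oppr0.
Qed.

Lemma Jmx_adj : J ^t* = - J.
Proof.
rewrite /Jmx tr_block_mx map_block_mx !trmx0 !map_mx0 opp_block_mx !oppr0 opprK.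
by rewrite adjmx1 adjmxN adjmx1.
Qed.

(* The system continued beyond N by S = 1 and Psi = 0, so that sequences on
   I^+ become sequences on nat which are constant from N + 1 on, and endpoint
   brackets become limits also for finite N. *)
Definition xS k : 'M[C]_(n + n) := if inI N k then Smx Y k else 1%:M.
Definition xPsi k : 'M[C]_(n + n) := if inI N k then Psi Y k else 0.

Lemma xS_symplectic k : (xS k) ^t* *m J *m xS k = J.
Proof.
rewrite /xS; case: ifP => [Ik|_]; first exact: Smx_symplectic.
by rewrite adjmx1 mul1mx mulmx1.
Qed.

Lemma xPsi_adj k : (xPsi k) ^t* = xPsi k.
Proof.
by rewrite /xPsi; case: ifP => [Ik|_]; [exact: Psi_hermitian | exact: adjmx0].
Qed.

Lemma xPsi_iso k : xPsi k *m J *m xPsi k = 0.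
Proof.
rewrite -{1}xPsi_adj /xPsi; case: ifP => [Ik|_]; first exact: Psi_isotropic.
by rewrite mulmx0.
Qed.

Lemma xPsi_ge0 k (v : 'cV[C]_(n + n)) : 0 <= (v ^t* *m xPsi k *m v) 0 0.
Proof.
rewrite /xPsi; case: ifP => [Ik|_]; first exact: Psi_psd.
by rewrite mulmx0 mul0mx mxE.
Qed.

Definition clip k : nat := if N is Some m then minn k m.+1 else k.

Lemma clip_in k : inIp N (clip k).
Proof. by rewrite /clip /inIp; case: N => // m; rewrite geq_minr. Qed.

Lemma clip_id k : inIp N k -> clip k = k.
Proof. by rewrite /clip /inIp; case: N => // m /minn_idPl. Qed.

Lemma inI_inIp k : inI N k -> inIp N k.
Proof. by rewrite /inI /inIp; case: N => // m /leqW. Qed.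

Lemma inI_inIpS k : inI N k -> inIp N k.+1.
Proof. by []. Qed.

Lemma clip_stable k : ~~ inI N k -> clip k.+1 = clip k.
Proof.
rewrite /inI /clip; case: N => // m; rewrite -ltnNge => mk.
by rewrite (minn_idPr _) ?(minn_idPr _) // ltnW.
Qed.

Definition ext (z : seqs) : mseq 1 := fun k => ev z (clip k).

Definition restr (w : mseq 1) : seqs := fun i => w (val i).

Lemma ev_val (z : seqs) (i : Ip N) : ev z (val i) = z i.
Proof. by rewrite /ev valK. Qed.

Lemma ext_val (z : seqs) (i : Ip N) : ext z (val i) = z i.
Proof. by rewrite /ext clip_id ?ev_val //; exact: (valP i). Qed.

Lemma extE (z : seqs) k : inIp N k -> ext z k = ev z k.
Proof. by move=> Ik; rewrite /ext clip_id. Qed.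

Lemma ext_inj : injective ext.
Proof. by move=> z u e; apply/funext => i; rewrite -!ext_val e. Qed.

Lemma extD z u : ext (z + u) = ext z + ext u.
Proof. by apply/funext => k; exact: evD. Qed.

Lemma extZ a z : ext (a *: z) = a *: ext z.
Proof. by apply/funext => k; exact: evZ. Qed.

Lemma ext0 : ext 0 = 0.
Proof. by rewrite -(scale0r 0) extZ !scale0r. Qed.

Lemma ext_sum I (s : seq I) (F : I -> seqs) :
  ext (\sum_(i <- s) F i) = \sum_(i <- s) ext (F i).
Proof. exact: (big_morph _ extD ext0). Qed.

Lemma ev_restr w k : inIp N k -> ev (restr w) k = w k.
Proof. by move=> Ik; rewrite /ev /restr insubT. Qed.

Lemma restrK w : (forall k, ~~ inI N k -> w k.+1 = w k) -> ext (restr w) = w.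
Proof.
move=> wc; apply/funext => k; rewrite /ext ev_restr ?clip_in //.
elim: k => [|k IH]; first by rewrite clip_id // /inIp; case: N.
have [Ik|nIk] := boolP (inI N k); first by rewrite clip_id // inI_inIpS.
by rewrite clip_stable // wc.
Qed.

Local Notation sys := (sys J xS xPsi).

Lemma sys_const p (A F : mseq p) k : sys A F -> ~~ inI N k -> A k.+1 = A k.
Proof.
move=> sA nIk; have := sA k; rewrite /xS /xPsi (negPf nIk) mul1mx => ->.
by rewrite mulmx0 mul0mx addr0.
Qed.

Lemma ext_restr w F : sys w F -> ext (restr w) = w.
Proof. by move=> sw; apply: restrK => k; exact: sys_const sw. Qed.

Lemma sys_ext z F : sys (ext z) F <->
  forall k, inI N k -> Smx Y k *m ev z k.+1 = ev z k + J *m Psi Y k *m F k.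
Proof.
split=> [sz k Ik|sz k].
  have := sz k; rewrite /xS /xPsi Ik !extE //; exact: inI_inIp.
rewrite /xS /xPsi; case: ifPn => [Ik|nIk].
  by rewrite !extE ?sz //; exact: inI_inIp.
by rewrite mul1mx mulmx0 mul0mx addr0 /ext clip_stable.
Qed.

Lemma LopE z f k : Lop Y z k = Psi Y k *m f <->
  Smx Y k *m ev z k.+1 = ev z k + J *m Psi Y k *m f.
Proof.
have JJl p (x : 'M[C]_(n + n, p)) : J *m (J *m x) = - x.
  by rewrite mulmxA Jmx_mul mulNmx mul1mx.
rewrite /Lop; split=> [e|->].
  by rewrite -mulmxA -e JJl opprB addrC subrK.
by rewrite opprD addrA subrr sub0r mulmxN -mulmxA JJl opprK.
Qed.

Lemma sys_Lop z (f : seqs) : sys (ext z) (ext f) <->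
  forall k, inI N k -> Lop Y z k = Psi Y k *m ev f k.
Proof.
rewrite sys_ext; split=> h k Ik; have eE := extE f (inI_inIp Ik).
  by apply/LopE; rewrite -eE; exact: h.
by rewrite eE; apply/LopE; exact: h.
Qed.

Lemma solutionE lam z : solution Y lam z <-> sys (ext z) (lam *: ext z).
Proof.
rewrite sys_ext /solution; split=> h k Ik; have := h k Ik.
all: have -> : (lam *: ext z) k = lam *: ev z k by rewrite -(extE z (inI_inIp Ik)).
all: have := xPsi_iso k; rewrite /xPsi Ik => iso.
all: have KK : J *m Psi Y k *m (J *m Psi Y k) = 0
  by rewrite -!mulmxA (mulmxA (Psi Y k)) iso mulmx0.
all: have VE : (Smx Y k + lam *: Vmx Y k) *m ev z k.+1 = Smx Y k *m ev z k.+1 -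
    lam *: (J *m Psi Y k *m (Smx Y k *m ev z k.+1)).
1, 3: by rewrite /Vmx mulmxDl -scalemxAl !mulNmx scalerN -!mulmxA.
  by rewrite VE -scalemxAr => /(nilpotent_resolvent lam _ _ KK).
by rewrite VE -scalemxAr => /(nilpotent_resolvent lam _ _ KK).
Qed.

Lemma wform_ip z u m :
  \sum_(0 <= k < m | inI N k) wform Y z u k = ip xPsi m (ext z) (ext u) 0 0.
Proof.
rewrite big_mkord /ip summxE [LHS]big_mkcond; apply: eq_bigr => k _.
rewrite /wform /xPsi; case: ifP => [Ik|_]; first by rewrite !extE ?inI_inIp.
by rewrite mulmx0 mul0mx mxE.
Qed.

Lemma innerE z u : inner Y z u = inn xPsi (ext z) (ext u) 0 0.
Proof. by rewrite /inner mxE; under eq_fun do rewrite wform_ip. Qed.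

Lemma bracket_endE z u : bracket_end z u = jend J (ext z) (ext u) 0 0.
Proof.
move: z u; rewrite /ext /clip /bracket_end; case: N => [m|] z u; last by rewrite mxE.
rewrite [jend _ _ _](mxcvg_jend (l := (ev z m.+1) ^t* *m J *m ev u m.+1)) //.
apply: mxcvg_near (@mxcvg_cst _ _ _ _).
by exists m.+1 => // k /= mk; rewrite /jform (minn_idPr _).
Qed.

(** * Classes of square summable sequences *)

Local Notation l2Y := (l2seq Y).
Local Notation class := (l2class Y).
Local Notation ipY := (ip xPsi).
Local Notation innY := (inn xPsi).
Local Notation boundedY := (bounded_norm xPsi).
Local Notation domY := (dom J xS xPsi).

Lemma ip_real m (w : mseq 1) : (complex.Re (ipY m w w 0 0))%:C%C = ipY m w w 0 0.
Proof. by rewrite RRe_real // ger0_real //; exact: (ip_ge0 xPsi_ge0). Qed.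

Lemma normsq_psum z m :
  (\sum_(0 <= k < m | inI N k) (complex.Re (wform Y z z k))%:E)%E =
  (complex.Re (ipY m (ext z) (ext z) 0 0))%:E.
Proof.
rewrite -wform_ip sumEFin; congr EFin; apply/esym.
exact: (big_morph (@complex.Re R) (@ReD R) erefl).
Qed.

Lemma ip_le_normsq z m :
  ((complex.Re (ipY m (ext z) (ext z) 0 0))%:E <= normsq Y z)%E.
Proof.
rewrite -normsq_psum; apply: nneseries_lim_ge => k _ Ik.
by rewrite lee_fin Re_wform_ge0.
Qed.

Lemma normsq_le z (K : C) : (forall m, ipY m (ext z) (ext z) 0 0 <= K) ->
  (normsq Y z <= (complex.Re K)%:E)%E.
Proof.
move=> zK; apply: lime_le.
  by apply: is_cvg_nneseries => k _ Ik; rewrite lee_fin Re_wform_ge0.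
apply: nearW => m; rewrite normsq_psum lee_fin.
by have := zK m; rewrite lecE => /andP[].
Qed.

Lemma ip_le_fine z m : z \in ell2 Y ->
  ipY m (ext z) (ext z) 0 0 <= (fine (normsq Y z))%:C%C.
Proof.
move=> /asboolP zfin; rewrite -ip_real lecR -lee_fin fineK ?ip_le_normsq //.
by rewrite ge0_fin_numE // normsq_ge0.
Qed.

Lemma ell2E z : z \in ell2 Y <-> boundedY (ext z).
Proof.
split=> [z2|[K zK]]; first by exists (fine (normsq Y z))%:C%C => m; exact: ip_le_fine.
by apply/asboolP; rewrite (le_lt_trans (normsq_le zK)) // ltry.
Qed.

Lemma ext_bounded (u : l2Y) : boundedY (ext u).
Proof. by apply/ell2E; exact: valP. Qed.

Lemma ext_l2 (u : l2Y) : l2 xPsi (ext u).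
Proof. exact/l2_vec/ext_bounded. Qed.

Lemma normsq_eq0 z : normsq Y z = 0%E <-> forall k, xPsi k *m ext z k = 0.
Proof.
split=> [z0 k|z0].
  apply: psd_null (xPsi_adj k) (xPsi_ge0 k) _; apply/eqP; rewrite eq_le xPsi_ge0 andbT.
  have : ipY k.+1 (ext z) (ext z) 0 0 <= 0.
    by have := ip_le_normsq z k.+1; rewrite z0 lee_fin -ip_real lecR.
  by apply: le_trans; rewrite ipS [leRHS]mxE lerDr ip_ge0 //; exact: xPsi_ge0.
apply/eqP; rewrite eq_le normsq_ge0 andbT; apply: (@normsq_le _ 0) => m.
by rewrite /ip big1 ?mxE // => k _; rewrite -mulmxA z0 mulmx0.
Qed.

Lemma cls_eqE (u v : l2Y) :
  cls u = cls v <-> forall k, xPsi k *m ext u k = xPsi k *m ext v k.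
Proof.
have e k : ext (l2val u - l2val v) k = ext u k - ext v k.
  by rewrite -(scaleN1r (l2val v)) extD extZ -[LHS]/(ext u k + -1 *: ext v k) scaleN1r.
split=> [/clsE/normsq_eq0 h k|h].
  by apply/eqP; rewrite -subr_eq0 -mulmxBr -e; apply/eqP; exact: h.
by apply/clsE/normsq_eq0 => k; rewrite e mulmxBr h subrr.
Qed.

Lemma ext_val_D (u v : l2Y) : ext (u + v) = ext u + ext v.
Proof. exact: extD. Qed.

Lemma ext_val_B (u v : l2Y) : ext (u - v) = ext u - ext v.
Proof.
by rewrite -[LHS]/(ext (l2val u - l2val v)) -(scaleN1r (l2val v)) extD extZ scaleN1r.
Qed.

Lemma ext_val_Z a (u : l2Y) : ext (a *: u) = a *: ext u.
Proof. exact: extZ. Qed.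

Lemma l2seq_of_sys w F : sys w F -> boundedY w -> exists u : l2Y, ext u = w.
Proof.
move=> sw w2; have e := ext_restr sw.
have r2 : restr w \in ell2 Y by apply/ell2E; rewrite e.
by exists (L2seq r2).
Qed.

(** Restriction to I^+ followed by extension changes [F] only where [xPsi] is zero. *)
Lemma l2seq_of_rhs F : boundedY F ->
  exists f : l2Y, forall k, xPsi k *m ext f k = xPsi k *m F k.
Proof.
move=> [K FK].
have e k : xPsi k *m ext (restr F) k = xPsi k *m F k.
  rewrite /xPsi; case: ifP => [Ik|_]; last by rewrite !mul0mx.
  by rewrite extE ?ev_restr ?inI_inIp.
have r2 : restr F \in ell2 Y.
  apply/ell2E; exists K => m.
  by rewrite (eq_ip_Psi m xPsi_adj e e); exact: FK.
by exists (L2seq r2).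
Qed.

Lemma cinnerE (u v : l2Y) : cinner (cls u) (cls v) = innY (ext u) (ext v) 0 0.
Proof.
have eu := (cls_eqE (repr (cls u)) u).1 (reprclsK _).
have ev := (cls_eqE (repr (cls v)) v).1 (reprclsK _).
by rewrite /cinner innerE (eq_inn_Psi xPsi_adj eu ev).
Qed.

Lemma cnorm_sqr (u : class) : cnorm u ^+ 2 = fine (normsq Y (repr u)).
Proof. by rewrite /cnorm sqr_sqrtr // fine_ge0 // normsq_ge0. Qed.

Lemma cnorm_ge0 (U : class) : 0 <= cnorm U.
Proof. exact: sqrtr_ge0. Qed.

Lemma ip_le_cnorm (U : class) m :
  ipY m (ext (repr U)) (ext (repr U)) 0 0 <= (cnorm U ^+ 2)%:C%C.
Proof. by rewrite cnorm_sqr; exact: ip_le_fine (valP (repr U)). Qed.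

Lemma cinner_le (U V : class) : `|cinner U V| <= (cnorm U * cnorm V)%:C%C.
Proof.
rewrite /cinner innerE.
have h : mxcvg _ _ :=
  inn_cvg xPsi_ge0 (@nondecreasing_cvgC R) (ext_l2 (repr U)) (ext_l2 (repr V)).
apply: (cvg_leC (cvg_norm (h 0 0)) (cvg_cst _)); apply: nearW => m /=.
apply: normC_le_mul (cnorm_ge0 U) (cnorm_ge0 V) _.
apply: le_trans (ip_cauchy_schwarz xPsi_adj xPsi_ge0 _ _ _) _.
apply: ler_pM (ip_le_cnorm U m) (ip_le_cnorm V m); exact: (ip_ge0 xPsi_ge0).
Qed.

Lemma clsB (u v : l2Y) : cls (u - v) = cls u - cls v.
Proof. by apply/eqP; rewrite eq_sym subr_eq -clsD subrK. Qed.

Lemma cinnerBr (U V V' : class) : cinner U (V - V') = cinner U V - cinner U V'.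
Proof.
rewrite -[U]reprclsK -[V]reprclsK -[V']reprclsK -clsB !cinnerE ext_val_B.
have l2 := ext_l2; have mono := @nondecreasing_cvgC R.
by rewrite (innBr xPsi_adj xPsi_ge0 mono (l2 (repr U)) (l2 (repr V)) (l2 (repr V'))) mxB_entry.
Qed.

(** By Cauchy-Schwarz, both sides of the equation defining the adjoint are continuous in p. *)
Lemma adjoint_closed (T : set (class * class)) :
  relclosure (adjoint T) `<=` adjoint T.
Proof.
move=> p pT r rT; apply/eqP; rewrite -subr_eq0 -normr_le0; apply/ler_addgt0Pl => e e0.
have [x [x0 xe]] : exists x : R, 0 < x /\ x%:C%C = e.
  exists (complex.Re e); rewrite RRe_real ?gtr0_real //.
  by move: e0; rewrite ltcE => /andP[].
pose k := cnorm r.1 + cnorm r.2 + 1.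
have k0 : 0 < k by rewrite ltr_wpDl // addr_ge0 ?cnorm_ge0.
have [|s [sT s1 s2]] := pT (x / k); first by rewrite divr_gt0.
have -> : cinner r.1 p.2 - cinner r.2 p.1 =
    cinner r.1 (p.2 - s.2) - cinner r.2 (p.1 - s.1).
  by rewrite !cinnerBr (sT r rT) opprB addrA subrK.
rewrite (le_trans (ler_normB _ _)) // (le_trans (lerD (cinner_le _ _) (cinner_le _ _))) //.
rewrite -xe addr0 -rmorphD lecR.
have := lerD (ler_wpM2l (cnorm_ge0 r.1) (ltW s2)) (ler_wpM2l (cnorm_ge0 r.2) (ltW s1)).
move=> /le_trans -> //; rewrite -mulrDl mulrCA ler_piMr ?(ltW x0) //.
by rewrite ler_pdivrMr // mul1r /k lerDl.
Qed.

Lemma inn_finl p r m (A : mseq p) (B : mseq r) : (forall k, (m <= k)%N -> A k = 0) ->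
  innY A B = ipY m A B.
Proof.
move=> A0; apply/matrixP => i j; rewrite [LHS]mxE.
suff h : mxcvg (fun k => ipY k A B) (ipY m A B) by exact: cvg_lim (h i j).
apply: mxcvg_near (@mxcvg_cst _ _ _ _); exists m => // k /= mk.
rewrite -(ip_adj xPsi_adj m B A) -(ip_adj xPsi_adj k B A) (ip_stable _ mk) //.
by move=> l ml; rewrite A0 // mulmx0.
Qed.

(** All terms are nonnegative, so the interval of SAC may be enlarged downwards to 0; the upper end
    becomes b + 1 because [ip] excludes its bound. *)
Lemma sac_definite : SAC Y -> exists b, forall (lam : C) (s : mseq 1),
  sys s (lam *: s) -> s 0%N != 0 -> 0 < ipY b s s 0 0.
Proof.
move=> [a [b [ab Ib def]]]; exists b.+1 => lam s ss s0.
have es := ext_restr ss.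
have Ik k : (k < b.+1)%N -> inI N k.
  by move: Ib; rewrite /inI; case: N => // m bm; rewrite ltnS => kb; exact: leq_trans kb bm.
have sol : solution Y lam (restr s) by apply/solutionE; rewrite es.
have nz : restr s <> 0.
  by move=> r0; move/eqP: s0; apply; rewrite -es r0 ext0.
apply: lt_le_trans (def _ _ sol nz) _.
rewrite -es -wform_ip es [leRHS](@big_cat_nat _ _ _ a) //=; last exact: leqW.
have -> : \sum_(a <= k < b.+1) wform Y (restr s) (restr s) k =
    \sum_(a <= k < b.+1 | inI N k) wform Y (restr s) (restr s) k.
  rewrite big_nat_cond [RHS]big_nat_cond; apply: eq_bigl => k.
  by case: (boolP (a <= k < b.+1)%N) => //= /andP[_ kb]; rewrite Ik.
by rewrite lerDr sumr_ge0 // => k; exact: wform_ge0.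
Qed.

Lemma ext_eventually0 z : (exists m, forall k, (m <= k)%N -> ev z k = 0) ->
    (forall m, N = Some m -> ev z m.+1 = 0) ->
  exists m, forall k, (m <= k)%N -> ext z k = 0.
Proof.
move: z; rewrite /ext /clip; case: N => [M|] z zm zN //.
by exists M.+1 => k Mk; rewrite (minn_idPr _) ?zN.
Qed.

Lemma represents_sys p (u : l2Y) : represents p u <->
  cls u = p.1 /\ sys (ext u) (ext (repr p.2)).
Proof.
split=> [[up [f fp uf]]|[up us]]; split=> //.
  have /sys_Lop := uf; apply: eq_sys => k.
  by apply: (cls_eqE f (repr p.2)).1 => //; rewrite reprclsK.
by exists (repr p.2); [exact: reprclsK | exact/sys_Lop].
Qed.

Lemma represents_lin a p r (u v : l2Y) :
  represents p u -> represents r v -> represents (a *: p + r) (a *: u + v).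
Proof.
move=> [up [f fp uf]] [vr [g gr vg]].
have cl (x y : l2Y) : cls (a *: x + y) = a *: cls x + cls y.
  by rewrite clsD -scale_cls.
split; first by rewrite cl up vr.
exists (a *: f + g); first by rewrite cl fp gr.
apply/sys_Lop; rewrite !ext_val_D !ext_val_Z.
by apply: sysD; [apply: sysZ|]; exact/sys_Lop.
Qed.

(** * Representatives under definiteness and the adjoint of the preminimal relation *)

Section Definite.
Variable b : nat.
Hypothesis definite : forall (lam : C) (s : mseq 1),
  sys s (lam *: s) -> s 0%N != 0 -> 0 < ipY b s s 0 0.

(** The difference of two representatives solves (S_0) and has norm zero, so by definiteness it
    starts at 0. *)
Lemma represents_unique p (u v : l2Y) : represents p u -> represents p v -> u = v.
Proof.
move=> /represents_sys[up us] /represents_sys[vp vs].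
apply/val_inj/ext_inj/eqP; rewrite -subr_eq0; apply/eqP.
set s := ext _ - ext _.
have s0 : sys s (0 *: s) by have := sysB us vs; rewrite subrr scale0r.
have uv : forall k, xPsi k *m s k = 0.
  move=> k; have /cls_eqE/(_ k) e : cls u = cls v by rewrite up vp.
  by rewrite -[s k]/(ext u k - ext v k) mulmxBr e subrr.
have := fundsolE Jmx_mul xS_symplectic s0 => ->.
have [->|nz] := eqVneq (s 0%N) 0.
  by apply/funext => k; exact: mulmx0.
have := definite s0 nz; rewrite /ip big1 ?mxE ?ltxx // => k _.
by rewrite -mulmxA uv mulmx0.
Qed.

Lemma hat_eq p (u : l2Y) : represents p u -> hat p = u.
Proof.
by move=> pu; apply: xget_unique => // v pv; exact: represents_unique pv pu.
Qed.

Lemma hatP p : Tmax Y p -> represents p (hat p).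
Proof. by move=> [u pu]; rewrite (hat_eq pu). Qed.

Definition pairof (p : class * class) : (mseq 1 * mseq 1)%type :=
  (ext (hat p), ext (repr p.2)).

Lemma dom_pairof p : Tmax Y p -> domY (pairof p).
Proof.
by move=> /hatP/represents_sys[_ ps]; split=> //=; exact: ext_l2.
Qed.

Lemma cinner_omega p r : Tmax Y p -> Tmax Y r ->
  cinner r.2 p.1 - cinner r.1 p.2 = omega xPsi (pairof r) (pairof p) 0 0.
Proof.
move=> /hatP/represents_sys[hp _] /hatP/represents_sys[hr _].
have e1 : cinner r.2 p.1 = innY (ext (repr r.2)) (ext (hat p)) 0 0.
  by rewrite -cinnerE hp reprclsK.
have e2 : cinner r.1 p.2 = innY (ext (hat r)) (ext (repr p.2)) 0 0.
  by rewrite -cinnerE hr reprclsK.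
by rewrite e1 e2 /omega mxB_entry.
Qed.

Lemma Tmax_of_dom P : domY P -> exists2 p, Tmax Y p & ext (hat p) = P.1.
Proof.
move=> [sP /l2_vec P1 /l2_vec P2].
have [u uP] := l2seq_of_sys sP P1; have [f fP] := l2seq_of_rhs P2.
have pu : represents (cls u, cls f) u.
  split=> //; exists f => //; apply/sys_Lop; rewrite uP.
  by apply: eq_sys sP => k; rewrite fP.
by exists (cls u, cls f); [exists u | rewrite (hat_eq pu)].
Qed.

Lemma T0_boundary p : T0 Y p -> [/\ Tmax Y p, ext (hat p) 0%N = 0 &
  exists m, forall k, (m <= k)%N -> ext (hat p) k = 0].
Proof.
move=> [u [pu um u0 uN]]; rewrite (hat_eq pu); split; first by exists u.
  by rewrite extE // /inIp; case: N.
exact: ext_eventually0 um uN.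
Qed.

Lemma finite_pair_T0 (z f : mseq 1) m : sys z f -> z 0%N = 0 ->
    (forall k, (m <= k)%N -> z k = 0 /\ f k = 0) ->
  exists u f' : l2Y, [/\ ext u = z, forall k, xPsi k *m ext f' k = xPsi k *m f k &
    T0 Y (cls u, cls f')].
Proof.
move=> sz z0 zm.
have fin (w : mseq 1) : (forall k, (m <= k)%N -> w k = 0) -> boundedY w.
  by move=> w0; apply/l2_vec; apply: (finite_l2 xPsi_ge0 w0).
have [u uz] := l2seq_of_sys sz (fin _ (fun k mk => (zm k mk).1)).
have [f' ff] := l2seq_of_rhs (fin _ (fun k mk => (zm k mk).2)).
exists u, f'; split=> //; exists u; split.
- split=> //; exists f' => //; apply/sys_Lop; rewrite uz.
  by apply: eq_sys sz => k; rewrite ff.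
- exists m => k mk; have [Ik|nIk] := boolP (inIp N k).
    by rewrite -extE // uz (zm k mk).1.
  by rewrite /ev insubN.
- by rewrite -extE ?uz //; rewrite /inIp; case: N.
(* [m] may exceed M + 1. The extended sequence is constant from M + 1 on, so its zero at the larger
   index is its value at M + 1. *)
move=> M NM; have := (zm _ (leq_maxl m M.+1)).1; rewrite -uz /ext.
by have -> : clip (maxn m M.+1) = M.+1 by rewrite /clip NM (minn_idPr _) ?leq_maxr.
Qed.

(** A solution [w] of L w = Psi g is corrected by a solution of L z = 0 so as to agree with [y]
    after multiplication by Psi. This puts it in the class p.1 and makes it square summable. *)
Lemma adjoint_T0_sub : adjoint (T0 Y) `<=` Tmax Y.
Proof.
move=> p pT0; set y := ext (repr p.1); set g := ext (repr p.2).
pose w := propagate J xS xPsi 0 g 0.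
have sw : sys w g.
  by have := propagate_sys xPsi Jmx_mul xS_symplectic 0 g 0; rewrite scale0r add0r.
have [c cy] : exists c : 'cV_(n + n), forall k,
    xPsi k *m (w k + fundsol J xS xPsi 0 k *m c) = xPsi k *m y k.
  apply: (adjoint_minimal Jmx_mul Jmx_adj xS_symplectic xPsi_adj xPsi_iso xPsi_ge0
    definite sw) => z f m sz z0 zm.
  have [u [f' [uz ff T0r]]] := finite_pair_T0 sz z0 zm.
  have := pT0 _ T0r; rewrite /= -[p.1]reprclsK -[p.2]reprclsK !cinnerE uz -/y -/g.
  rewrite (eq_inn_Psi xPsi_adj ff (fun=> erefl)).
  rewrite !(@inn_finl _ _ m) => [e|k /zm[]|k /zm[]] //.
  by apply/matrixP => i j; rewrite !ord1.
pose u := w + mulr_mseq (fundsol J xS xPsi 0) c.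
have su : sys u g.
  have := sysD sw (sys_fundsolM xPsi Jmx_mul xS_symplectic 0 c).
  by rewrite scale0r addr0.
have [K yK] := ext_bounded (repr p.1).
have u2 : boundedY u by exists K => m; rewrite (eq_ip_Psi m xPsi_adj cy cy); exact: yK.
have [v vu] := l2seq_of_sys su u2.
exists v; apply/represents_sys; split; last by rewrite vu.
by rewrite -[p.1]reprclsK; apply/cls_eqE => k; rewrite vu; exact: cy.
Qed.

End Definite.

Lemma cnorm0 : cnorm (0 : class) = 0.
Proof.
have c0 : cls 0 = 0 :> class by rewrite -(subrr 0) clsB subrr.
rewrite /cnorm; have -> : normsq Y (repr (0 : class)) = 0%E; last by rewrite sqrtr0.
apply/normsq_eq0 => k; have /cls_eqE -> : cls (repr (0 : class)) = cls 0.
  by rewrite reprclsK c0.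
by rewrite [ext _]ext0 mulmx0.
Qed.

Lemma T0_sub_Tmin : T0 Y `<=` Tmin Y.
Proof. by move=> p pT eps e0; exists p; rewrite !subrr cnorm0. Qed.

(** * Self-adjoint extensions *)

Section Extensions.
Variables (q Q : nat) (B : 'M[C]_Q) (beta : class * class -> 'cV[C]_Q).
Hypothesis QE : Q = (q + q)%N.
Hypothesis Badj : B ^t* = - B.
Hypothesis Bunit : B \in unitmx.
Hypothesis beta_lin : forall a p r, Tmax Y p -> Tmax Y r ->
  beta (a *: p + r) = a *: beta p + beta r.
Hypothesis beta_onto : forall w, exists2 p, Tmax Y p & beta p = w.
Hypothesis beta_green : forall p r, Tmax Y p -> Tmax Y r ->
  cinner r.2 p.1 - cinner r.1 p.2 = ((beta r) ^t* *m B *m beta p) 0 0.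
Hypothesis T0_sub : T0 Y `<=` [set p | Tmax Y p /\ beta p = 0].
Hypothesis adjoint_T0 : adjoint (T0 Y) `<=` Tmax Y.

Lemma beta_orth p r : Tmax Y p -> Tmax Y r ->
  (cinner r.1 p.2 = cinner r.2 p.1 <-> (beta r) ^t* *m B *m beta p = 0).
Proof.
move=> pm rm; have H := beta_green pm rm; split=> [e|e].
  apply/matrixP => i j; rewrite !ord1 [RHS]mxE.
  by move: H; rewrite e subrr.
by apply/esym/eqP; rewrite -subr_eq0 H e mxE.
Qed.

Lemma adjoint_anti (T T' : set (class * class)) : T `<=` T' -> adjoint T' `<=` adjoint T.
Proof. by move=> TT' p pT' r rT; apply: pT'; exact: TT'. Qed.

Lemma selfadjoint_extensionP (T : set (class * class)) : linear_relation T ->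
  (self_adjoint T /\ Tmin Y `<=` T) <->
  exists K : 'M[C]_(q, Q), [/\ \rank K = q, K *m invmx B *m K ^t* = 0 &
    T = [set p | Tmax Y p /\ K *m beta p = 0]].
Proof.
move=> [T00 Tlin]; split=> [[sT minT]|[K [rK KBK TE]]].
  have T0T : T0 Y `<=` T by apply: subset_trans minT; exact: T0_sub_Tmin.
  have TTmax : T `<=` Tmax Y.
    by rewrite sT => p /(adjoint_anti T0T); exact: adjoint_T0.
  pose V : set 'cV[C]_Q := [set w | exists2 p, T p & beta p = w].
  (* As T is its own adjoint, membership of p is an orthogonality condition that depends on p only
     through its boundary value; so T is the full preimage of [V]. *)
  have Torth p : Tmax Y p -> (T p <-> forall v, V v -> v ^t* *m B *m beta p = 0).
    move=> pm; split=> [pT _ [r rT <-]|orth].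
      by apply/(beta_orth pm (TTmax _ rT)); move: pT; rewrite sT; apply.
    rewrite sT => r rT; apply/(beta_orth pm (TTmax _ rT)).
    by apply: orth; exists r.
  have beta0 : beta 0 = 0.
    have m0 := TTmax _ T00; have := beta_lin 1 m0 m0.
    by rewrite !scale1r addr0 => e; apply: (addrI (beta 0)); rewrite addr0 -e.
  have [||w|K [rK KBK VK]] := @kernel_of_lagrangian _ q Q B QE Badj Bunit V.
  - by exists 0.
  - move=> a _ _ [p pT <-] [r rT <-]; exists (a *: p + r); first exact: Tlin.
    by rewrite beta_lin //; exact: TTmax.
  - have [p pm pw] := beta_onto w; rewrite -pw; split=> [[r rT rp] v Vv|].
      by rewrite -rp; exact: ((Torth _ (TTmax _ rT)).1 rT v Vv).
    by move=> /(Torth _ pm) pT; exists p.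
  exists K; split=> //; apply/seteqP; split=> p /=.
    by move=> pT; split; [exact: TTmax | apply/VK; exists p].
  move=> [pm /VK [r rT rp]]; apply/(Torth _ pm); rewrite -rp.
  by apply/Torth => //; exact: TTmax.
have lag := @lagrangian_of_kernel _ q Q B QE Badj Bunit K _ rK KBK.
have T0T : T0 Y `<=` T.
  by rewrite TE => p /T0_sub[pm p0]; split=> //; rewrite p0 mulmx0.
have sT : T = adjoint T.
  apply/seteqP; split=> p.
    rewrite {1}TE => -[pm Kp] r; rewrite TE => -[rm Kr]; apply/(beta_orth pm rm).
    exact: ((lag _).1 Kp).
  move=> pT; have pm : Tmax Y p by apply/adjoint_T0; exact: adjoint_anti T0T _ pT.
  rewrite TE; split=> //; apply/lag => v Kv; have [r rm rv] := beta_onto v.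
  rewrite -rv; apply/(beta_orth pm rm)/pT.
  by rewrite TE; split=> //; rewrite rv.
(* Being an adjoint, T is closed, so with [T0] it contains the closure of [T0]. *)
split=> // p pmin; rewrite sT; apply: adjoint_closed => eps e0.
have [r [rT r1 r2]] := pmin eps e0; exists r.
by split; [rewrite -sT; exact: T0T | exact: r1 | exact: r2].
Qed.

End Extensions.

(** * Families of solutions as matrix-valued sequences *)

Definition mseq_of q (psi : 'I_q -> seqs) : mseq q :=
  fun k => \matrix_(i, j) ext (psi j) k i 0.

Lemma col_mseq_of q (psi : 'I_q -> seqs) j k : col j (mseq_of psi k) = ext (psi j) k.
Proof. by apply/matrixP => i l; rewrite !mxE ord1. Qed.

Lemma mseq_ofM q (psi : 'I_q -> seqs) (x : 'cV[C]_q) :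
  mulr_mseq (mseq_of psi) x = ext (\sum_j x j 0 *: psi j).
Proof.
apply/funext => k; rewrite ext_sum fct_sumE; apply/matrixP => i l.
rewrite ord1 mxE summxE; apply: eq_bigr => j _.
by rewrite extZ -[(_ *: _) k]/(_ *: ext (psi j) k) !mxE mulrC.
Qed.

Lemma jend_mseq_of q q' (psi : 'I_q -> seqs) (psi' : 'I_q' -> seqs) i j :
  jend J (mseq_of psi) (mseq_of psi') i j = bracket_end (psi i) (psi' j).
Proof.
rewrite bracket_endE !mxE; congr (limn _); apply/funext => k.
have e : delta_mx 0 i *m jform J (mseq_of psi) (mseq_of psi') k *m delta_mx j (0 : 'I_1) =
    jform J (ext (psi i)) (ext (psi' j)) k.
  rewrite /jform -(col_mseq_of psi) -(col_mseq_of psi') !colE adjmxM adjmx_delta.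
  by rewrite !mulmxA.
by rewrite -e -rowE -colE !mxE.
Qed.

Section Solutions.
Variables (lam : C) (q : nat) (psi : 'I_q -> seqs).
Hypothesis dimq : has_dim (sqsol Y lam) q.
Hypothesis psi_sol : forall i, sqsol Y lam (psi i).
Hypothesis psi_free : lin_indep psi.

Lemma mseq_of_sys : sys (mseq_of psi) (lam *: mseq_of psi).
Proof.
move=> k; apply: eq_colP => j.
have /solutionE/(_ k) := (psi_sol j).1; rewrite -[(_ *: ext _) k]/(lam *: ext _ k).
rewrite -!(col_mseq_of psi) !colE -[(_ *: mseq_of _) k]/(lam *: mseq_of psi k).
by rewrite scalemxAl !mulmxA -mulmxDl.
Qed.

Lemma mseq_of_l2 : l2 xPsi (mseq_of psi).
Proof.
apply: (l2_col xPsi_ge0) => j.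
have -> : (fun k => col j (mseq_of psi k)) = ext (psi j).
  by apply/funext => k; exact: col_mseq_of.
by apply/ell2E; exact: (psi_sol j).2.
Qed.

(** A solution is determined by its value at 0, so independence of the sequences passes to their
    initial values. *)
Lemma mseq_of_free (x : 'cV[C]_q) : mseq_of psi 0%N *m x = 0 -> x = 0.
Proof.
move=> x0; apply/matrixP => j l; rewrite ord1 [RHS]mxE; move: j.
apply: psi_free; apply: ext_inj; rewrite -mseq_ofM ext0.
have s : sys (mulr_mseq (mseq_of psi) x) (lam *: mulr_mseq (mseq_of psi) x).
  have := sysM x mseq_of_sys; congr (_ _); apply/funext => k.
  by rewrite /mulr_mseq -scalemxAl.
rewrite (fundsolE Jmx_mul xS_symplectic s) [X in mulr_mseq _ X]x0.
by apply/funext => k; exact: mulmx0.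
Qed.

(** [has_dim] provides some basis [e]; the square matrix expressing the q independent solutions in
    it has trivial kernel, hence is invertible. *)
Lemma sqsol_span z : sqsol Y lam z -> exists x : 'cV[C]_q, z = \sum_j x j 0 *: psi j.
Proof.
have [e [e_free spanE]] := dimq; rewrite spanE => -[c ->].
have /choice[a aE] : forall i, exists a : 'I_q -> C, psi i = \sum_j a j *: e j.
  by move=> i; have := psi_sol i; rewrite spanE.
pose A : 'M[C]_q := \matrix_(i, j) a i j.
have psiE (v : 'rV[C]_q) : \sum_i v 0 i *: psi i = \sum_j (v *m A) 0 j *: e j.
  under eq_bigr do rewrite aE scaler_sumr.
  rewrite exchange_big; apply: eq_bigr => j _.
  by rewrite mxE scaler_suml; apply: eq_bigr => i _; rewrite scalerA mxE.
have Au : A \in unitmx.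
  rewrite -row_free_unit -kermx_eq0; apply/eqP/row_matrixP => i; rewrite row0.
  set v := row i _; have vA : v *m A = 0 by rewrite -row_mul mulmx_ker row0.
  apply/matrixP => l j; rewrite ord1 [RHS]mxE; move: j; apply: psi_free.
  by rewrite psiE vA big1 // => j _; rewrite mxE scale0r.
exists ((\row_j c j) *m invmx A)^T.
under [RHS]eq_bigr do rewrite mxE.
by rewrite psiE mulmxKV //; apply: eq_bigr => j _; rewrite mxE.
Qed.

Lemma mseq_of_span (c : 'cV[C]_(n + n)) :
    boundedY (mulr_mseq (fundsol J xS xPsi lam) c) ->
  exists x : 'cV[C]_q, mulr_mseq (fundsol J xS xPsi lam) c = mulr_mseq (mseq_of psi) x.
Proof.
have s := sys_fundsolM xPsi Jmx_mul xS_symplectic lam c; have e := ext_restr s.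
move=> bd; have [|x xE] := @sqsol_span (restr (mulr_mseq (fundsol J xS xPsi lam) c)).
  by split; [apply/solutionE; rewrite e | apply/ell2E; rewrite e].
by exists x; rewrite -e xE mseq_ofM.
Qed.

End Solutions.

End Extension.

(** * The matrix of the boundary form and its inverse *)

Section BoundaryMatrix.
Variables (C : numClosedFieldType) (d r : nat) (J : 'M[C]_d) (Omega : 'M[C]_r).
Hypothesis JJ : J *m J = - 1%:M.
Hypothesis Jadj : J ^t* = - J.
Hypothesis OmegaU : Omega \in unitmx.
Hypothesis Omega_skew : Omega ^t* = - Omega.

Lemma boundary_mx_mulV :
  boundary_mx J Omega *m block_mx J 0 0 (- Omega) = 1%:M.
Proof.
rewrite /boundary_mx mulmx_block !(mulmx0, mul0mx, addr0, add0r) !(mulNmx, mulmxN) opprK.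
by rewrite JJ opprK mulVmx // -scalar_mx_block.
Qed.

Lemma boundary_mx_unit : boundary_mx J Omega \in unitmx.
Proof. by case/mulmx1_unit: boundary_mx_mulV. Qed.

Lemma boundary_mx_inv : invmx (boundary_mx J Omega) = block_mx J 0 0 (- Omega).
Proof.
by rewrite -[RHS](mulKmx boundary_mx_unit) boundary_mx_mulV mulmx1.
Qed.

Lemma boundary_mx_adj : (boundary_mx J Omega) ^t* = - boundary_mx J Omega.
Proof.
have e : (invmx Omega) ^t* = - invmx Omega.
  rewrite -[LHS]mulmx1 -(mulmxV OmegaU) mulmxA -[X in _ *m X *m _](opprK Omega).
  by rewrite -Omega_skew mulmxN -adjmxM mulmxV // adjmx1 mulNmx mul1mx.
rewrite /boundary_mx tr_block_mx map_block_mx !trmx0 !map_mx0 !adjmxN Jadj e.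
by rewrite opp_block_mx !oppr0.
Qed.

Lemma boundary_mx_form q (M : 'M[C]_(q, d)) (L : 'M[C]_(q, r)) :
  row_mx M (- L) *m invmx (boundary_mx J Omega) *m (row_mx M (- L)) ^t* =
  M *m J *m M ^t* - L *m Omega *m L ^t*.
Proof.
rewrite boundary_mx_inv mul_row_block !(mulmx0, addr0, add0r).
rewrite tr_row_mx map_col_mx mul_row_col adjmxN.
by rewrite !(mulmxN, mulNmx) opprK.
Qed.

End BoundaryMatrix.

Lemma rank_row_mxN (F : fieldType) q d r (M : 'M[F]_(q, d)) (L : 'M[F]_(q, r)) :
  \rank (row_mx M (- L)) = \rank (row_mx M L).
Proof.
have le (X : 'M[F]_(q, r)) : (\rank (row_mx M (- X)) <= \rank (row_mx M X))%N.
  have -> : row_mx M (- X) = row_mx M X *m block_mx 1%:M 0 0 (- 1%:M).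
    by rewrite mul_row_block !mulmx0 addr0 add0r mulmxN !mulmx1.
  exact: mxrankM_maxl.
by apply/eqP; rewrite eqn_leq le /=; have := le (- L); rewrite opprK.
Qed.

Lemma conj_sub_neq0 (R : realType) (lam : CC R) : 0 < complex.Im lam -> lam - lam^* != 0.
Proof.
case: lam => a b /= b0; apply/eqP => /(congr1 (@complex.Im R)) /=.
by move=> /eqP; rewrite opprK -mulr2n mulrn_eq0 /= gt_eqF.
Qed.

Section Head.
Variables (R : realType) (n : nat) (N : option nat) (q : nat).
Variable phi : 'I_(q + q) -> dseq R n N.
Local Notation C := (CC R).
Local Notation r := (q + q - (n + n))%N.

Definition head_mx : 'M[C]_(r, q + q) := rowsub (@head_idx q n) 1%:M.

Lemma head_mxE p (A : 'M[C]_(q + q, p)) : head_mx *m A = rowsub (@head_idx q n) A.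
Proof. by rewrite /head_mx mul_rowsub_mx mul1mx. Qed.

Lemma head_mx_adjE p (A : 'M[C]_(p, q + q)) :
  A *m head_mx ^t* = \matrix_(i, j) A i (head_idx j).
Proof.
rewrite -[LHS]trmxCK adjmxM trmxCK head_mxE.
by apply/matrixP => i j; rewrite !mxE conjCK.
Qed.

Lemma mseq_of_head : mulr_mseq (mseq_of phi) (head_mx ^t*) = mseq_of (phi \o @head_idx q n).
Proof.
apply/funext => k; rewrite /mulr_mseq head_mx_adjE.
by apply/matrixP => i j; rewrite !mxE.
Qed.

Lemma defpair_mseq_of lam :
  (defpair lam (mseq_of (fun i => phi (lshift q i))) (mseq_of (fun j => phi (rshift q j)))).1
  = mseq_of phi.
Proof.
apply/funext => k; apply/matrixP => i j; rewrite !mxE; case: splitP => l jl; rewrite !mxE.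
all: by congr (ext (phi _) k i 0); apply: val_inj.
Qed.

Lemma mseq_of_vec (z : dseq R n N) : mseq_of (fun _ : 'I_1 => z) = ext z.
Proof. by apply/funext => k; apply/matrixP => i j; rewrite mxE ord1. Qed.

End Head.

Theorem theorem3p3 (R : realType) (n : nat) (N : option nat)
    (Y : dsystem R n N) (hn : (0 < n)%N) (hSAC : SAC Y)
    (q : nat) (hqp : is_qplus Y q) (hqm : is_qminus Y q)
    (lam0 : CC R) (hlam0 : 0 < complex.Im lam0)
    (phi : 'I_(q + q) -> dseq R n N)
    (hphi1 : forall i : 'I_q, sqsol Y lam0 (phi (lshift q i)))
    (hfree1 : lin_indep (fun i : 'I_q => phi (lshift q i)))
    (hphi2 : forall j : 'I_q, sqsol Y (lam0^*) (phi (rshift q j)))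
    (hfree2 : lin_indep (fun j : 'I_q => phi (rshift q j)))
    (hrank : \rank (\matrix_(i < q + q - (n + n), j < q)
               bracket_end (phi (head_idx i)) (phi (rshift q j)))
             = (q + q - (n + n))%N)
    (T : set (l2class Y * l2class Y)) (hT : linear_relation T) :
  let Omega : 'M[CC R]_(q + q - (n + n)) :=
    \matrix_(i, j) bracket_end (phi (head_idx i)) (phi (head_idx j)) in
  (self_adjoint T /\ Tmin Y `<=` T) <->
  exists (M : 'M[CC R]_(q, n + n)) (L : 'M[CC R]_(q, q + q - (n + n))),
    [/\ \rank (row_mx M L) = q,
        M *m Jmx R n *m M ^t* - L *m Omega *m L ^t* = 0 &
        T = [set p | Tmax Y p /\
              M *m ev (hat p) 0
              - L *m (\col_i bracket_end (phi (head_idx i)) (hat p)) = 0]].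
Proof.
move=> Omega; have [b def] := sac_definite hSAC.
pose psi1 (i : 'I_q) := phi (lshift q i); pose psi2 (j : 'I_q) := phi (rshift q j).
have dim1 := hqp _ hlam0.
have dim2 : has_dim (sqsol Y lam0^*) q.
  by apply: hqm; case: (lam0) hlam0 => a c /=; rewrite oppr_lt0.
have [A AD AE] : exists2 A : 'M[CC R]_(q + q), A = jend (Jmx R n) (mseq_of phi) (mseq_of phi) &
    forall i j, A i j = bracket_end (phi i) (phi j).
  by eexists; [reflexivity | exact: jend_mseq_of].
have OmegaE : Omega = head_mx R n q *m A *m (head_mx R n q) ^t*.
  by rewrite head_mxE head_mx_adjE; apply/matrixP => i j; rewrite !mxE AE.
have rankU : \rank (head_mx R n q *m A) = (q + q - (n + n))%N.
  (* The matrix of the rank hypothesis consists of the last q columns of the head rows of [A], so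
     its rank bounds theirs from below. *)
  apply/eqP; rewrite eqn_leq rank_leq_row /= -{1}hrank.
  have -> : (\matrix_(i, j) bracket_end (phi (head_idx i)) (phi (rshift q j))) =
      head_mx R n q *m A *m col_mx 0 1%:M.
    rewrite head_mxE -[rowsub _ A]hsubmxK mul_row_col mulmx0 add0r mulmx1.
    by apply/matrixP => i j; rewrite !mxE AE.
  exact: mxrankM_maxl.
have [] := boundary_triple (@Jmx_mul R n) (@Jmx_adj R n) (@xS_symplectic _ _ _ Y)
  (@xPsi_adj _ _ _ Y) (@xPsi_iso _ _ _ Y) (@xPsi_ge0 _ _ _ Y) def (@cauchy_cvgC R)
  (@nondecreasing_cvgC R) (conj_sub_neq0 hlam0)
  (mseq_of_sys hphi1) (mseq_of_sys hphi2) (mseq_of_l2 hphi1) (mseq_of_l2 hphi2)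
  (mseq_of_free hphi1 hfree1) (mseq_of_free hphi2 hfree2)
  (mseq_of_span dim1 hphi1 hfree1) (mseq_of_span dim2 hphi2 hfree2)
  (erefl (q + q - (n + n))%N) (U := head_mx R n q) (Omega := Omega).
- by rewrite defpair_mseq_of -AD.
- by rewrite defpair_mseq_of -AD.
move=> dimE [Ou Oadj] blin onto green.
have [beta betaD betaE] : exists2 beta : l2class Y * l2class Y -> 'cV[CC R]_(n + n + _),
    forall p, beta p = col_mx (ev (hat p) 0)
      (\col_i bracket_end (phi (@head_idx q n i)) (hat p)) &
    forall p, boundary_value (Jmx R n) lam0 (mseq_of psi1) (mseq_of psi2) (head_mx R n q)
      (pairof p) = beta p.
  eexists; [by move=> p; reflexivity | move=> p].
  rewrite /boundary_value defpair_mseq_of mseq_of_head /pairof /= extE; last first.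
    by rewrite /inIp; case: (N).
  congr col_mx; rewrite -[ext (hat p)]mseq_of_vec; apply/matrixP => i j.
  by rewrite jend_mseq_of [RHS]mxE.
have lin a p r : Tmax Y p -> Tmax Y r -> beta (a *: p + r) = a *: beta p + beta r.
  move=> pm rm; have hp := hatP def pm; have hr := hatP def rm.
  have dp := dom_pairof def pm; have dr := dom_pairof def rm.
  have hpr := hat_eq def (represents_lin a hp hr).
  (* Only the first components are compared: the chosen representatives of the second ones need not
     add up, and the boundary value ignores them. *)
  have e : (pairof (a *: p + r)).1 = (a *: pairof p + pairof r).1.
    by rewrite -[LHS]/(ext (hat (a *: p + r))) hpr ext_val_D ext_val_Z.
  rewrite -(betaE (a *: p + r)) -(betaE p) -(betaE r).
  rewrite -(blin a (pairof p) (pairof r) dp dr).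
  by rewrite /boundary_value e.
have bonto w : exists2 p, Tmax Y p & beta p = w.
  have [P dP Pw] := onto w; have [p pm pP] := Tmax_of_dom def dP.
  exists p => //; rewrite -betaE -Pw /boundary_value /pairof /= pP //.
have bgreen p r : Tmax Y p -> Tmax Y r -> cinner r.2 p.1 - cinner r.1 p.2 =
    ((beta r) ^t* *m boundary_mx (Jmx R n) Omega *m beta p) 0 0.
  move=> pm rm; rewrite (cinner_omega def pm rm).
  rewrite (green _ _ (dom_pairof def rm) (dom_pairof def pm)).
  by rewrite (betaE p) (betaE r).
have bT0 : T0 Y `<=` [set p | Tmax Y p /\ beta p = 0].
  move=> x /(T0_boundary def)[xm x0 xz]; split=> //.
  rewrite -(betaE x) /boundary_value -[(pairof x).1]/(ext (hat x)) x0.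
  by rewrite (jend0r _ _ xz) col_mx0.
apply: iff_trans (selfadjoint_extensionP dimE (boundary_mx_adj (@Jmx_adj R n) Ou Oadj)
  (boundary_mx_unit (@Jmx_mul R n) Ou) lin bonto bgreen bT0
  (@adjoint_T0_sub _ _ _ Y b def) hT) _.
have KE (M : 'M[CC R]_(q, n + n)) (L : 'M[CC R]_(q, q + q - (n + n))) p :
    row_mx M (- L) *m beta p =
    M *m ev (hat p) 0 - L *m (\col_i bracket_end (phi (head_idx i)) (hat p)).
  by rewrite betaD mul_row_col mulNmx.
have JOform := boundary_mx_form (@Jmx_mul R n) Ou.
split=> [[K [rK KBK TE]]|[M [L [rML MJM TE]]]].
  have KML : row_mx (lsubmx K) (- (- rsubmx K)) = K by rewrite opprK hsubmxK.
  exists (lsubmx K), (- rsubmx K); split.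
  - by rewrite -rank_row_mxN KML.
  - by rewrite -JOform KML.
  - by rewrite TE; apply/funext => p /=; rewrite -KE KML.
exists (row_mx M (- L)); split.
- by rewrite rank_row_mxN.
- by rewrite JOform.
- by rewrite TE; apply/funext => p /=; rewrite KE.
Qed.
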